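(* Let $n\ge2$ and $k\ge2$ be integers, let $\varepsilon\ge0$, and assume that there exists a non-connected domain $\Omega=A\cup B$ in $\mathbb{R}^n$ (with $A$ and $B$ disjoint domains) such that $|A|+|B|=1$, $|A|>\varepsilon/\lambda^*_k(n)^{n/2}$, $|B|>\varepsilon/\lambda^*_k(n)^{n/2}$ and $$\lambda_k(A\cup B)^{n/2}\le\lambda^*_k(n)^{n/2}+\varepsilon.$$ Then there exists an integer $i\in\{1,\dots,k-1\}$ such that $$0\le\left\{\lambda^*_i(n)^{n/2}+\lambda^*_{k-i}(n)^{n/2}\right\}-\lambda^*_k(n)^{n/2}\le\varepsilon,$$ $$0\le\lambda_i(A)^{n/2}|A|-\lambda^*_i(n)^{n/2}\le\varepsilon\quad\text{and}\quad 0\le\lambda_{k-i}(B)^{n/2}|B|-\lambda^*_{k-i}(n)^{n/2}\le\varepsilon.$$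
   Context: ''Domain'' means a bounded open subset of $\mathbb{R}^n$ with sufficiently regular boundary (e.g. Lipschitz); domains are not required to be connected. $|\Omega|$ denotes the volume of $\Omega$. $0<\lambda_1(\Omega)\le\lambda_2(\Omega)\le\cdots$ are the eigenvalues of the (positive) Laplacian on $\Omega$ with Dirichlet boundary conditions, repeated according to multiplicity. The spectrum of a disjoint union $A\cup B$ is the re-ordered union (with multiplicity) of the spectra of $A$ and $B$. Define $\lambda^*_k(n)=\inf\{\lambda_k(\Omega):\Omega\subset\mathbb{R}^n\text{ a domain},\ |\Omega|=1\}$. *)

(* Defs.v *)
From HB Require Import structures.
From mathcomp Require Import all_boot all_order all_algebra.
From mathcomp Require Import all_classical all_reals all_analysis.

Set Implicit Arguments.
Unset Strict Implicit.
Unset Printing Implicit Defensive.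

Import Order.TTheory GRing.Theory Num.Theory.
Import numFieldNormedType.Exports.

Local Open Scope classical_set_scope.
Local Open Scope ring_scope.

(* R^n is 'rV[R]_n, whose library norm is the sup norm; since all norms are
   equivalent, this is harmless for the topology, boundedness and Lipschitz
   continuity, which are the only uses made of it. *)

(** Domains *)

Definition dot (R : realType) (n : nat) (x y : 'rV[R]_n) : R :=
  \sum_(i < n) x 0 i * y 0 i.

(* For a unit vector v, [x - dot x v *: v] is the orthogonal projection of x on
   the hyperplane orthogonal to v.  So, near each boundary point, Omega is the
   region strictly above the graph, in the direction v, of a Lipschitz function
   on that hyperplane.  (Lipschitz functions on a hyperplane extend to R^n, so
   it is no restriction to take g defined on R^n.) *)
Definition lipschitz_boundary (R : realType) (n : nat)
    (Omega : set 'rV[R]_n) : Prop :=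
  forall p, (closure Omega `\` interior Omega) p ->
  exists (v : 'rV[R]_n) (g : 'rV[R]_n -> R),
    [/\ dot v v = 1,
        lipschitz g &
        \forall x \near p, Omega x <-> g (x - dot x v *: v) < dot x v].

Definition domain (R : realType) (n : nat) (Omega : set 'rV[R]_n) : Prop :=
  [/\ bounded_set Omega, open Omega & lipschitz_boundary Omega].

(** Volume: n-dimensional Lebesgue (outer) measure, by countable coverings with
    closed boxes.  It is only applied to open sets, which are measurable. *)

Definition box (R : realType) (n : nat) (a b : 'rV[R]_n) : set 'rV[R]_n :=
  [set x | forall i, a 0 i <= x 0 i <= b 0 i].

Definition volume (R : realType) (n : nat) (A : set 'rV[R]_n) : \bar R :=
  ereal_inf [set s | exists a b : nat -> 'rV[R]_n,
    [/\ forall j i, a j 0 i <= b j 0 i,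
        A `<=` \bigcup_j box (a j) (b j) &
        s = (\sum_(0 <= j <oo) (\prod_(i < n) (b j 0 i - a j 0 i))%:E)%E]].

(** Dirichlet eigenvalues *)

Definition partial (R : realType) (n : nat) (i : 'I_n)
    (u : 'rV[R]_n -> R) : 'rV[R]_n -> R :=
  fun x => 'D_(delta_mx 0 i) u x.

Definition C1_on (R : realType) (n : nat) (U : set 'rV[R]_n)
    (u : 'rV[R]_n -> R) : Prop :=
  forall x, U x -> forall i,
    derivable u x (delta_mx 0 i) /\ {for x, continuous (partial i u)}.

Definition C2_on (R : realType) (n : nat) (U : set 'rV[R]_n)
    (u : 'rV[R]_n -> R) : Prop :=
  C1_on U u /\ forall i, C1_on U (partial i u).

Definition laplacian (R : realType) (n : nat)
    (u : 'rV[R]_n -> R) (x : 'rV[R]_n) : R :=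
  \sum_(i < n) partial i (partial i u) x.

(* Functions on closure Omega are represented by their extension by zero, so
   that equality of eigenfunctions is equality of functions on R^n; as Omega is
   open, vanishing off Omega includes the boundary condition.  On a bounded
   Lipschitz domain every boundary point is regular, so these classical
   eigenfunctions are exactly the H^1_0 ones. *)
Definition dirichlet_eigenfunction (R : realType) (n : nat)
    (Omega : set 'rV[R]_n) (mu : R) (u : 'rV[R]_n -> R) : Prop :=
  [/\ C2_on Omega u,
      {within closure Omega, continuous u},
      forall x, ~ Omega x -> u x = 0 &
      forall x, Omega x -> - laplacian u x = mu * u x].

Definition lin_indep (R : realType) (T : Type) (m : nat)
    (u : 'I_m -> T -> R) : Prop :=
  forall c : 'I_m -> R,
    (forall x, \sum_(j < m) c j * u j x = 0) -> forall j, c j = 0.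

(* Dimension of the eigenspace; it is 0 when mu is not an eigenvalue. *)
Definition multiplicity (R : realType) (n : nat) (Omega : set 'rV[R]_n)
    (mu : R) : \bar R :=
  ereal_sup [set m%:R%:E | m in [set m : nat |
    exists u : 'I_m -> 'rV[R]_n -> R,
      (forall j, dirichlet_eigenfunction Omega mu (u j)) /\ lin_indep u]].

(* Number of eigenvalues <= t, counted with multiplicity. *)
Definition eigenvalue_count (R : realType) (n : nat) (Omega : set 'rV[R]_n)
    (t : R) : \bar R :=
  \esum_(mu in [set mu : R | mu <= t]) multiplicity Omega mu.

(* The k-th term (k >= 1) of the nondecreasing list of the eigenvalues repeated
   according to multiplicity is the least t such that at least k of them are
   <= t. *)
Definition lambda (R : realType) (n k : nat) (Omega : set 'rV[R]_n) : \bar R :=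
  ereal_inf [set t%:E | t in
    [set t : R | (k%:R%:E <= eigenvalue_count Omega t)%E]].

Definition lambda_star (R : realType) (n k : nat) : \bar R :=
  ereal_inf [set lambda k Omega | Omega in
    [set Omega : set 'rV[R]_n | domain Omega /\ volume Omega = 1%:E]].

(* Main.v *)
Require Import Defs.
From HB Require Import structures.
From mathcomp Require Import all_boot all_order all_algebra.
From mathcomp Require Import all_classical all_reals all_analysis.
From mathcomp Require Import ring lra.

Set Implicit Arguments.
Unset Strict Implicit.
Unset Printing Implicit Defensive.

Import Order.TTheory GRing.Theory Num.Theory.
Import numFieldNormedType.Exports.

Local Open Scope classical_set_scope.
Local Open Scope ring_scope.

(** Write [p = n / 2]. For an open set the power [lambda k W `^ p] times the volume
    of [W] does not change under similarities, so it is at least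
    [lambda_star n k `^ p] for every domain of positive volume ([lambda_star_le]).

    The spectrum of a disjoint union is the union of the spectra, so the [k]
    lowest eigenvalues of [A `|` B] consist of [i] eigenvalues of [A] and [k - i]
    eigenvalues of [B], for some [i] between 0 and [k] ([lambda_setU_split]). With
    [L = lambda k (A `|` B) `^ p] this gives
    [lambda i A `^ p * volume A + lambda (k - i) B `^ p * volume B <= L], the
    volumes having sum 1, and [L] is at most [lambda_star n k `^ p + eps]. The two
    terms on the left are bounded below by [lambda_star n i `^ p] and
    [lambda_star n (k - i) `^ p], and the sum of these is at least
    [lambda_star n k `^ p] by the Wolf-Keller construction, which puts two scaled
    domains side by side ([lambda_star_subadd]). All the inequalities of the
    theorem say that the total gap [eps] bounds the gap of each step. The cases
    [i = 0] and [i = k] are impossible: one part would then carry all [k]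
    eigenvalues, and the part left out is too large for that.

    The computation takes place in the reals, so [lambda_star n k] has to be
    finite, and the eigenvalues have to be positive. Finiteness comes from the first eigenvalue of a cube, with eigenfunction a
    product of cosines ([lambda1_cube]), and from subadditivity
    ([lambda_star_lty]). A maximum principle bounds the eigenvalues of a bounded
    open set away from zero ([eigenvalue_lower_bound]). Positivity of
    [lambda_star] itself follows from the hypotheses: if it vanished, the
    assumption on the volumes would force [eps = 0], and then
    [lambda k (A `|` B) = 0]. *)

(** * Dirichlet eigenfunctions form a vector space *)

Lemma near_cvg_eq (T V : topologicalType) (f g : T -> V) (x : T) (l : V) :
  (\near x, f x = g x) -> f @ x --> l -> g @ x --> l.
Proof. by move=> fg; apply: cvg_trans; exact: near_eq_cvg. Qed.

Lemma partial_eq (R : realType) (n : nat) (U : set 'rV[R]_n) (i : 'I_n)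
    (u v : 'rV[R]_n -> R) :
  open U -> (forall x, U x -> u x = v x) ->
  forall x, U x -> partial i u x = partial i v x.
Proof.
move=> oU uv x Ux; apply: near_eq_derive.
by near=> y; apply: uv; near: y; exact: open_nbhs_nbhs.
Unshelve. all: by end_near. Qed.

Lemma C1_on_eq (R : realType) (n : nat) (U : set 'rV[R]_n)
    (u v : 'rV[R]_n -> R) :
  open U -> (forall x, U x -> u x = v x) -> C1_on U u -> C1_on U v.
Proof.
move=> oU uv C1u x Ux i; have [du cu] := C1u x Ux i; split.
  apply: near_eq_derivable du.
  by near=> y; apply: uv; near: y; exact: open_nbhs_nbhs.
suff: partial i v @ x --> partial i v x by [].
rewrite -(partial_eq i oU uv Ux).
apply: near_cvg_eq cu.
by near=> y; apply: (partial_eq i oU uv); near: y; exact: open_nbhs_nbhs.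
Unshelve. all: by end_near. Qed.

Lemma C2_on_eq (R : realType) (n : nat) (U : set 'rV[R]_n)
    (u v : 'rV[R]_n -> R) :
  open U -> (forall x, U x -> u x = v x) -> C2_on U u -> C2_on U v.
Proof.
move=> oU uv [C1u C2u]; split; first exact: C1_on_eq C1u.
move=> i; apply: C1_on_eq (C2u i) => //; exact: partial_eq.
Qed.

Lemma laplacian_eq (R : realType) (n : nat) (U : set 'rV[R]_n)
    (u v : 'rV[R]_n -> R) :
  open U -> (forall x, U x -> u x = v x) ->
  forall x, U x -> laplacian u x = laplacian v x.
Proof.
move=> oU uv x Ux; apply: eq_bigr => i _.
by apply: (@partial_eq _ _ U) => // y Uy; exact: (@partial_eq _ _ U).
Qed.

Lemma partial_lin (R : realType) (n : nat) (U : set 'rV[R]_n) (a : R)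
    (u v : 'rV[R]_n -> R) (i : 'I_n) x : C1_on U u -> C1_on U v ->
  U x -> partial i (fun y => a * u y + v y) x = a * partial i u x + partial i v x.
Proof.
move=> C1u C1v Ux; have [du _] := C1u x Ux i; have [dv _] := C1v x Ux i.
rewrite /partial -/((a *: u : 'rV[R]_n -> R) \+ v) deriveD//; last exact: derivableZ.
by rewrite deriveZ.
Qed.

Lemma C1_on_lin (R : realType) (n : nat) (U : set 'rV[R]_n) (a : R)
    (u v : 'rV[R]_n -> R) : open U -> C1_on U u -> C1_on U v ->
  C1_on U (fun y => a * u y + v y).
Proof.
move=> oU C1u C1v x Ux i; have [du cu] := C1u x Ux i.
have [dv cv] := C1v x Ux i; split.
  by apply: derivableD => //; exact: derivableZ.
set w := fun y => a * u y + v y.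
suff: partial i w @ x --> partial i w x by [].
rewrite (partial_lin a i C1u C1v Ux).
apply: (@near_cvg_eq _ _ (fun y => a * partial i u y + partial i v y)).
  near=> y.
  by rewrite (partial_lin a i C1u C1v)//; near: y; exact: open_nbhs_nbhs.
exact: (cvgD (cvgM (cvg_cst a) cu) cv).
Unshelve. all: by end_near. Qed.

Lemma C2_on_lin (R : realType) (n : nat) (U : set 'rV[R]_n) (a : R)
    (u v : 'rV[R]_n -> R) : open U -> C2_on U u -> C2_on U v ->
  C2_on U (fun y => a * u y + v y).
Proof.
move=> oU [C1u C2u] [C1v C2v]; split; first exact: C1_on_lin.
move=> i; apply: (@C1_on_eq _ _ U (fun y => a * partial i u y + partial i v y)).
- exact: oU.
- by move=> x Ux; rewrite (partial_lin a i C1u C1v).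
- exact: C1_on_lin.
Qed.

Lemma laplacian_lin (R : realType) (n : nat) (U : set 'rV[R]_n) (a : R)
    (u v : 'rV[R]_n -> R) x : open U -> C2_on U u -> C2_on U v -> U x ->
  laplacian (fun y => a * u y + v y) x = a * laplacian u x + laplacian v x.
Proof.
move=> oU [C1u C2u] [C1v C2v] Ux.
rewrite /laplacian mulr_sumr -big_split/=; apply: eq_bigr => i _.
rewrite -(partial_lin a i (C2u i) (C2v i) Ux).
apply: (partial_eq i oU) => // y Uy; exact: partial_lin C1u C1v Uy.
Qed.

(** Vanishing off the open set turns continuity up to the boundary into
    continuity on the whole space, which no longer depends on the open set. *)
Lemma eigenfunction_continuous (R : realType) (n : nat) (U : set 'rV[R]_n)
    (u : 'rV[R]_n -> R) : open U ->
  {within closure U, continuous u} -> (forall x, ~ U x -> u x = 0) ->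
  continuous u.
Proof.
move=> oU cu u0.
suff cvgu (x : 'rV[R]_n) : u @ x --> u x by move=> x; exact: cvgu.
have [cUx|ncUx] := pselect (closure U x); last first.
  have ux0 : u x = 0 by apply: u0 => Ux; exact/ncUx/subset_closure.
  rewrite ux0.
  suff ux_near : \forall y \near x, u y = 0 by exact: (cvg_near_cst _ ux_near).
  near=> y; rewrite u0//.
  have : (~` closure U) y.
    near: y; apply: open_nbhs_nbhs; split => //; apply: closed_openC; exact: closed_closure.
  by move=> ncy Uy; exact/ncy/subset_closure.
have [Ux|nUx] := pselect (U x).
  have : {in U, continuous u}.
    rewrite -continuous_open_subspace//.
    exact: continuous_subspaceW (@subset_closure _ U) cu.
  by apply; rewrite inE.
apply/(@cvgrPdist_lt _ _ _ (nbhs x)) => e e0.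
move/subspace_continuousP : cu => /(_ x cUx) cu.
have /cvgrPdist_lt /(_ e e0) := cu.
move=> h; have : \forall y \near x, closure U y -> `|u x - u y| < e by exact: h.
apply: filterS => y hy; have [Uy|nUy] := pselect (U y).
  exact/hy/subset_closure.
by rewrite !u0// subrr normr0.
Unshelve. all: by end_near. Qed.

Lemma eigenfunctionP (R : realType) (n : nat) (U : set 'rV[R]_n) (mu : R)
    (u : 'rV[R]_n -> R) : open U ->
  dirichlet_eigenfunction U mu u <->
  [/\ C2_on U u, continuous u, forall x, ~ U x -> u x = 0 &
      forall x, U x -> - laplacian u x = mu * u x].
Proof.
move=> oU; split=> -[C2u cu u0 eu]; split => //.
  exact: eigenfunction_continuous cu u0.
exact: continuous_subspaceT.
Qed.

Lemma eigenfunction_lin (R : realType) (n : nat) (U : set 'rV[R]_n) (mu a : R)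
    (u v : 'rV[R]_n -> R) : open U ->
  dirichlet_eigenfunction U mu u -> dirichlet_eigenfunction U mu v ->
  dirichlet_eigenfunction U mu (fun x => a * u x + v x).
Proof.
move=> oU /(eigenfunctionP mu u oU)[C2u cu u0 eu].
move=> /(eigenfunctionP mu v oU)[C2v cv v0 ev].
apply: (eigenfunctionP mu _ oU).2; split.
- exact: C2_on_lin.
- move=> x; exact: (cvgD (cvgM (cvg_cst a) (cu x)) (cv x)).
- by move=> x Ux; rewrite u0// v0// mulr0 addr0.
- move=> x Ux; rewrite (laplacian_lin a oU C2u C2v Ux).
  have := eu x Ux; have := ev x Ux.
  move: (laplacian u x) (laplacian v x) => p q vE uE.
  by rewrite opprD -mulrN uE vE; ring.
Qed.

Lemma eigenfunction0 (R : realType) (n : nat) (U : set 'rV[R]_n) (mu : R) :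
  dirichlet_eigenfunction U mu (fun=> 0).
Proof.
have p0 (i : 'I_n) : partial i (fun _ : 'rV[R]_n => 0 : R) = fun=> 0.
  by apply/funext => x; exact: derive_cst.
have c0 : continuous (fun _ : 'rV[R]_n => 0 : R) by exact: cst_continuous.
have C10 : C1_on U (fun=> 0 : R).
  move=> x _ i; split; first exact: derivable_cst.
  by rewrite p0; exact: c0.
split => //.
- by split => // i; rewrite p0.
- exact: continuous_subspaceT.
- move=> x _; rewrite /laplacian big1 ?mulr0 ?oppr0// => i _.
  by rewrite !p0.
Qed.

Lemma eigenfunction_sum (R : realType) (n : nat) (U : set 'rV[R]_n) (mu : R)
    (m : nat) (c : 'I_m -> R) (u : 'I_m -> 'rV[R]_n -> R) : open U ->
  (forall j, dirichlet_eigenfunction U mu (u j)) ->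
  dirichlet_eigenfunction U mu (fun x => \sum_(j < m) c j * u j x).
Proof.
move=> oU eu; elim: (index_enum _) => [|j s IHs].
  under eq_fun do rewrite big_nil; exact: eigenfunction0.
by under eq_fun do rewrite big_cons; exact: eigenfunction_lin.
Qed.

(** * Eigenvalues of a disjoint union *)

(** A boundary point of [A] lies outside [B], as [B] is open and disjoint from
    [A]; so [u] already vanishes there and the cut-off creates no jump. *)
Lemma eigenfunction_restrict (R : realType) (n : nat) (A B : set 'rV[R]_n)
    (mu : R) (u : 'rV[R]_n -> R) : open A -> open B -> A `&` B = set0 ->
  dirichlet_eigenfunction (A `|` B) mu u -> dirichlet_eigenfunction A mu (u \_ A).
Proof.
move=> oA oB AB0 /(eigenfunctionP mu u (openU oA oB))[[C1u C2u] cu u0 eu].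
have uA x : A x -> u x = (u \_ A) x by move=> Ax; rewrite patchE mem_set.
have ucA x : closure A x -> u x = (u \_ A) x.
  move=> cAx; have [/uA//|nAx] := pselect (A x).
  rewrite patchE memNset//; apply: u0 => -[//|Bx].
  have [y [Ay By]] := cAx B (open_nbhs_nbhs (conj oB Bx)).
  by have : (A `&` B) y by []; rewrite AB0.
have C2A : C2_on A u.
  by split => [x Ax|i x Ax]; [apply: C1u|apply: C2u]; left.
split.
- exact: C2_on_eq C2A.
- apply: (@subspace_eq_continuous _ _ _ (u : subspace (closure A) -> R)).
    by move=> x; rewrite inE; exact: ucA.
  exact: continuous_subspaceT.
- by move=> x Ax; rewrite patchE memNset.
- move=> x Ax; rewrite -(laplacian_eq oA uA Ax) -uA//; apply: eu; by left.
Qed.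

(** On the part [B] the function is identically zero, which solves the equation
    for every [mu]. *)
Lemma eigenfunction_extend (R : realType) (n : nat) (A B : set 'rV[R]_n)
    (mu : R) (u : 'rV[R]_n -> R) : open A -> open B -> A `&` B = set0 ->
  dirichlet_eigenfunction A mu u -> dirichlet_eigenfunction (A `|` B) mu u.
Proof.
move=> oA oB AB0 /(eigenfunctionP mu u oA)[[C1u C2u] cu u0 eu].
have uB x : B x -> 0 = u x.
  by move=> Bx; rewrite u0// => Ax; have : (A `&` B) x by []; rewrite AB0.
have [[C10 C20] _ _ e0] := eigenfunction0 B mu.
have [C1B C2B] : C2_on B u by exact: C2_on_eq uB _.
apply: (eigenfunctionP mu u (openU oA oB)).2.
split => //.
- by split=> [x|i x] []; [exact: C1u|exact: C1B|exact: C2u|exact: C2B].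
- by move=> x ABx; apply: u0 => Ax; apply: ABx; left.
- move=> x [Ax|Bx]; first exact: eu.
  by rewrite -(laplacian_eq oB uB Bx) -uB// e0.
Qed.

(** Rank-nullity for the restriction to [A], without quotients: a maximal
    subfamily whose restrictions to [A] are independent spans the image, and
    subtracting from each remaining function its expression on [A] in that
    subfamily produces independent functions vanishing on [A]. *)
Lemma lin_indep_split (R : realType) (T : Type) (A : set T) (m : nat)
    (u : 'I_m -> T -> R) : lin_indep u ->
  exists (p q : nat) (f : 'I_p -> 'I_m) (g : 'I_q -> 'I_m -> R),
    [/\ (p + q)%N = m,
        lin_indep (fun i => u (f i) \_ A),
        lin_indep (fun i x => \sum_(j < m) g i j * u j x) &
        forall i x, A x -> \sum_(j < m) g i j * u j x = 0].
Proof.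
move=> iu.
pose li (S : {set 'I_m}) := `[< forall c : 'I_m -> R,
  (forall x, A x -> \sum_(j in S) c j * u j x = 0) -> forall j, j \in S -> c j = 0 >].
have li0 : li finset.set0 by apply/asboolP => c _ j; rewrite inE.
case: (@arg_maxnP _ finset.set0 li (fun S : {set 'I_m} => #|S|) li0) => S /asboolP liS maxS.
have /choice[d dE] : forall j, exists dj : 'I_m -> R, j \notin S ->
    forall x, A x -> u j x = \sum_(i in S) dj i * u i x.
  move=> j.
  have [jS|jS] := boolP (j \in S); first by exists (fun=> 0).
  have : ~~ li (j |: S).
    apply/negP => /maxS; by rewrite /= cardsU1 jS add1n ltnn.
  move/asboolPn/existsNP => [c /not_implyP[cE /existsNP[k /not_implyP[kS ck]]]].
  have cSE x : A x -> c j * u j x + \sum_(i in S) c i * u i x = 0.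
    by move=> /cE; rewrite big_setU1.
  have cj : c j != 0.
    apply/eqP => cj0; apply: ck.
    move: kS; rewrite !inE => /orP[/eqP -> //|kS].
    by apply: liS kS => x /cSE; rewrite cj0 mul0r add0r.
  exists (fun i => - (c i / c j)) => _ x /cSE/eqP.
  rewrite addr_eq0 => /eqP cu.
  rewrite -[LHS](mulKf cj) cu mulrN mulr_sumr -sumrN; apply: eq_bigr => i _.
  by field.
(* Row [i] of [g] subtracts from the [i]-th function outside [S] its expression
   on [A]. *)
exists #|S|, #|~: S|, enum_val.
exists (fun i j => (j == enum_val i)%:R - (if j \in S then d (enum_val i) j else 0)).
have gE (i : 'I_#|~: S|) x : \sum_(j < m) ((j == enum_val i)%:R -
    (if j \in S then d (enum_val i) j else 0)) * u j x =
    u (enum_val i) x - \sum_(j in S) d (enum_val i) j * u j x.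
  under eq_bigr do rewrite mulrBl.
  rewrite big_split/= sumrN; congr (_ - _).
    rewrite (bigD1 (enum_val i))//= eqxx mul1r big1 ?addr0// => j /negbTE ->.
    by rewrite mul0r.
  by rewrite [RHS]big_mkcond/=; apply: eq_bigr => j _; case: ifP => // _; rewrite mul0r.
split.
- by rewrite cardsC card_ord.
- move=> c cE i0.
  pose c' k := \sum_(i < #|S|) c i * (enum_val i == k)%:R.
  have c'E i : c' (enum_val i) = c i.
    rewrite /c' (bigD1 i)//= eqxx mulr1 big1 ?addr0// => k ki.
    by rewrite (inj_eq enum_val_inj) (negbTE ki) mulr0.
  rewrite -c'E; apply: liS; last exact: enum_valP.
  move=> x Ax; rewrite big_enum_val/= -[RHS](cE x); apply: eq_bigr => i _.
  by rewrite c'E patchE mem_set.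
- move=> c cE i0.
  have /iu/(_ (enum_val i0)) : forall x, \sum_(j < m) (\sum_(i < #|~: S|) c i *
      ((j == enum_val i)%:R - (if j \in S then d (enum_val i) j else 0))) * u j x = 0.
    move=> x; rewrite -[RHS](cE x).
    under [RHS]eq_bigr do rewrite mulr_sumr.
    rewrite [RHS]exchange_big/=; apply: eq_bigr => j _.
    by rewrite mulr_suml; apply: eq_bigr => i _; rewrite mulrA.
  have := enum_valP i0; rewrite inE => /negbTE -> <-.
  rewrite (bigD1 i0)//= eqxx subr0 mulr1 big1 ?addr0// => k ki.
  by rewrite (inj_eq enum_val_inj) eq_sym (negbTE ki) subr0 mulr0.
- move=> i x Ax; rewrite gE -dE ?subrr//.
  by have := enum_valP i; rewrite inE.
Qed.

Lemma multiplicity_ge (R : realType) (n m : nat) (W : set 'rV[R]_n) (mu : R)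
    (u : 'I_m -> 'rV[R]_n -> R) :
  (forall j, dirichlet_eigenfunction W mu (u j)) -> lin_indep u ->
  (m%:R%:E <= multiplicity W mu)%E.
Proof. by move=> eu iu; apply: ereal_sup_ubound; exists m => //; exists u. Qed.

Lemma multiplicity_ge0 (R : realType) (n : nat) (W : set 'rV[R]_n) (mu : R) :
  (0 <= multiplicity W mu)%E.
Proof.
by apply: (@multiplicity_ge _ _ 0 _ _ (fun=> fun=> 0)) => [[]//|c _ []].
Qed.

Lemma multiplicity_nat (R : realType) (n : nat) (W : set 'rV[R]_n) (mu : R) :
  multiplicity W mu = +oo%E \/ exists m : nat, multiplicity W mu = m%:R%:E.
Proof.
have := multiplicity_ge0 W mu.
case E : (multiplicity W mu) => [r| |]//; last by left.
rewrite lee_fin => r0; right; exists (Num.trunc r).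
apply/eqP; rewrite eqe eq_le; have /andP[-> rlt] := truncn_itv r0; rewrite andbT.
rewrite -lee_fin -E; apply: ge_ereal_sup => _ [m mW <-].
rewrite lee_fin ler_nat -ltnS -(ltr_nat R); apply: le_lt_trans rlt.
by rewrite -lee_fin -E; apply: ereal_sup_ubound; exists m.
Qed.

(** An eigenfunction of the union is the sum of its two cut-offs. Splitting a
    basis along restriction to [A] gives one inequality, joining a family on [A]
    with a family on [B] gives the other. *)
Lemma multiplicity_setU (R : realType) (n : nat) (A B : set 'rV[R]_n) (mu : R) :
  open A -> open B -> A `&` B = set0 ->
  multiplicity (A `|` B) mu = (multiplicity A mu + multiplicity B mu)%E.
Proof.
move=> oA oB AB0; have oAB := openU oA oB; apply/eqP; rewrite eq_le; apply/andP; split.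
  apply: ge_ereal_sup => _ [m [u [eu iu]] <-].
  have [p [q [f [g [pq iA iB g0]]]]] := lin_indep_split A iu.
  rewrite -{1}pq natrD EFinD; apply: leeD.
    apply: multiplicity_ge iA => j; exact: eigenfunction_restrict (eu _).
  apply: multiplicity_ge iB => j.
  set w := fun x => _.
  have ew : dirichlet_eigenfunction (B `|` A) mu w.
    by rewrite setUC; exact: eigenfunction_sum.
  suff -> : w = w \_ B.
    by apply: eigenfunction_restrict ew => //; rewrite setIC.
  apply/funext => x; rewrite patchE; case: ifPn => // /negP; rewrite inE => nBx.
  have [Ax|nAx] := pselect (A x); first exact: g0.
  by have [_ _ -> //] := ew => -[].
have joint p q (u : 'I_p -> 'rV[R]_n -> R) (v : 'I_q -> 'rV[R]_n -> R) :
    (forall j, dirichlet_eigenfunction A mu (u j)) -> lin_indep u ->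
    (forall j, dirichlet_eigenfunction B mu (v j)) -> lin_indep v ->
    (p%:R%:E + q%:R%:E <= multiplicity (A `|` B) mu)%E.
  move=> eu iu ev iv; rewrite -EFinD -natrD.
  pose w (j : 'I_(p + q)) := match fintype.split j with inl j => u j | inr j => v j end.
  apply: (@multiplicity_ge _ _ _ _ _ w) => [j|c cE].
    rewrite /w; case: fintype.split => i; first exact: eigenfunction_extend.
    by rewrite setUC; apply: eigenfunction_extend => //; rewrite setIC.
  have u0 j x : ~ A x -> u j x = 0 by have [_ _ + _] := eu j; apply.
  have v0 j x : ~ B x -> v j x = 0 by have [_ _ + _] := ev j; apply.
  have wE x : \sum_i c (lshift q i) * u i x + \sum_i c (rshift p i) * v i x = 0.
    rewrite -[RHS](cE x) big_split_ord/=; congr (_ + _); apply: eq_bigr => i _.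
      by rewrite /w (unsplitK (inl i)).
    by rewrite /w (unsplitK (inr i)).
  have nAB x : A x -> ~ B x.
    by move=> Ax Bx; have : (A `&` B) x by []; rewrite AB0.
  have ca i : c (lshift q i) = 0.
    apply: (iu (fun i => c (lshift q i))) => x; have [Ax|nAx] := pselect (A x).
      by rewrite -[RHS](wE x) [X in _ = _ + X]big1 ?addr0// => j _; rewrite v0 ?mulr0//; exact: nAB.
    by rewrite big1// => j _; rewrite u0 ?mulr0.
  have cb i : c (rshift p i) = 0.
    apply: (iv (fun i => c (rshift p i))) => x; rewrite -[RHS](wE x).
    by rewrite [X in _ = X + _]big1 ?add0r// => j _; rewrite ca mul0r.
  by move=> j; rewrite -(splitK j); case: fintype.split => i /=; [exact: ca|exact: cb].
have M0 := multiplicity_ge0 (A `|` B) mu.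
case EM : (multiplicity (A `|` B) mu) M0 => [M| |]// M0; last by rewrite leey.
have Bfin : multiplicity B mu \is a fin_num.
  rewrite ge0_fin_numE ?multiplicity_ge0//; apply: (@le_lt_trans _ _ M%:E); last exact: ltry.
  apply: ge_ereal_sup => _ [q [v [ev iv]] <-]; rewrite -[leLHS]add0e -EM.
  by apply: (joint 0 q (fun=> fun=> 0) v) => //; [case|move=> c _ []].
rewrite -leeBrDr//; apply: ge_ereal_sup => _ [p [u [eu iu]] <-].
rewrite leeBrDr// addeC -leeBrDr//; apply: ge_ereal_sup => _ [q [v [ev iv]] <-].
by rewrite leeBrDr// addeC -EM; exact: joint iv.
Qed.

Lemma eigenvalue_count_ge0 (R : realType) (n : nat) (W : set 'rV[R]_n) (t : R) :
  (0 <= eigenvalue_count W t)%E.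
Proof. by apply: esum_ge0 => mu _; exact: multiplicity_ge0. Qed.

Lemma eigenvalue_count_le (R : realType) (n : nat) (W : set 'rV[R]_n) (s t : R) :
  s <= t -> (eigenvalue_count W s <= eigenvalue_count W t)%E.
Proof.
move=> st; apply: ereal_sup_le => _ [X [fX Xs] <-]; exists X => //; split => //.
by move=> mu /Xs/= /le_trans; apply.
Qed.

Lemma eigenvalue_count_setU (R : realType) (n : nat) (A B : set 'rV[R]_n) (t : R) :
  open A -> open B -> A `&` B = set0 ->
  eigenvalue_count (A `|` B) t = (eigenvalue_count A t + eigenvalue_count B t)%E.
Proof.
move=> oA oB AB0; rewrite /eigenvalue_count -esumD; last 2 first.
- by move=> mu _; exact: multiplicity_ge0.
- by move=> mu _; exact: multiplicity_ge0.
by apply: eq_esum => mu _; exact: multiplicity_setU.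
Qed.

(** A supremum of sums of integers, so the counting function takes no value
    strictly between two consecutive integers. *)
Lemma eigenvalue_count_nat (R : realType) (n i : nat) (W : set 'rV[R]_n) (t : R) :
  (eigenvalue_count W t < i.+1%:R%:E)%E -> (eigenvalue_count W t <= i%:R%:E)%E.
Proof.
move=> Nlt; apply: ge_ereal_sup => _ [X fX <-].
have : (\sum_(mu \in X) multiplicity W mu < i.+1%:R%:E)%E.
  by apply: le_lt_trans Nlt; apply: ereal_sup_ubound; exists X.
have [finX _] := fX; rewrite fsbig_finite//=.
have [->//|[m ->]] : (\sum_(mu <- finmap.enum_fset (fset_set X)) multiplicity W mu)%E = +oo%E \/
    exists m : nat, (\sum_(mu <- finmap.enum_fset (fset_set X)) multiplicity W mu)%E = m%:R%:E.
  elim/big_ind : _ => [|x y|mu _]; last exact: multiplicity_nat.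
    by right; exists 0%N.
  move=> [->|[p ->]] [->|[q ->]]; [by left..|].
  by right; exists (p + q)%N; rewrite natrD.
by rewrite lte_fin lee_fin ltr_nat ltnS ler_nat.
Qed.

Lemma lambda_le (R : realType) (n k : nat) (W : set 'rV[R]_n) (t : R) :
  (k%:R%:E <= eigenvalue_count W t)%E -> (lambda k W <= t%:E)%E.
Proof. by move=> kN; apply: ereal_inf_lbound; exists t. Qed.

Lemma lambda_lt (R : realType) (n k : nat) (W : set 'rV[R]_n) (t : R) :
  (lambda k W < t%:E)%E -> (k%:R%:E <= eigenvalue_count W t)%E.
Proof.
move=> /ereal_inf_lt[_ [s ks <-]]; rewrite lte_fin => /ltW st.
exact: le_trans ks (eigenvalue_count_le _ st).
Qed.

Lemma lambda_setU_le (R : realType) (n i j : nat) (A B : set 'rV[R]_n) (t : R) :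
  open A -> open B -> A `&` B = set0 ->
  (lambda i A <= t%:E)%E -> (lambda j B <= t%:E)%E ->
  (lambda (i + j) (A `|` B) <= t%:E)%E.
Proof.
move=> oA oB AB0 iA jB; apply/lee_addgt0Pr => e e0; rewrite -EFinD.
have tlt : (t%:E < (t + e)%:E)%E by rewrite lte_fin ltrDl.
apply: lambda_le; rewrite eigenvalue_count_setU// natrD EFinD.
by apply: leeD; apply: lambda_lt; [exact: le_lt_trans iA tlt|exact: le_lt_trans jB tlt].
Qed.

(** Among the [k] lowest eigenvalues of a disjoint union, [i] belong to one part
    and [k - i] to the other. The infimum defining [lambda] need not be attained a
    priori, so counting only yields an [i] for each level above it; as [i] takes
    finitely many values, one of them works at levels arbitrarily close to the
    infimum. With [i = 0] the first bound holds because [lambda 0 A] is [-oo]. *)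
Lemma lambda_setU_split (R : realType) (n k : nat) (A B : set 'rV[R]_n) :
  open A -> open B -> A `&` B = set0 ->
  exists i, [/\ (i <= k)%N, (lambda i A <= lambda k (A `|` B))%E &
                (lambda (k - i) B <= lambda k (A `|` B))%E].
Proof.
move=> oA oB AB0; apply: contrapT => /forallNP noi.
(* If no [i] worked, the minimum over [i] of these maxima would exceed the
   infimum, leaving room for a level [t] in between. *)
pose m i := maxe (lambda i A) (lambda (k - i) B).
pose M := \big[mine/+oo%E]_(i < k.+1) m i.
have LM : (lambda k (A `|` B) < +oo -> lambda k (A `|` B) < M)%E.
  move=> Loo; rewrite /M; elim/big_ind : _ => // [x y xL yL|i _].
    by rewrite lt_min xL.
  rewrite ltNge; apply/negP; rewrite ge_max => /andP[iA iB].
  by apply: (noi i); split => //; rewrite -ltnS.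
have [Loo|] := ltP (lambda k (A `|` B)) +oo%E; last first.
  rewrite leye_eq => /eqP Loo; apply: (noi 0%N).
  by split => //; rewrite Loo leey.
have [_ [t kt <-] tM] := ereal_inf_lt (LM Loo).
move: kt; rewrite /= eigenvalue_count_setU// => kt.
have [i [ik iA iB]] : exists i, [/\ (i <= k)%N,
    (i%:R%:E <= eigenvalue_count A t)%E & ((k - i)%:R%:E <= eigenvalue_count B t)%E].
  have [kA|] := leP k%:R%:E (eigenvalue_count A t).
    by exists k; rewrite subnn eigenvalue_count_ge0.
  case E : (eigenvalue_count A t) (eigenvalue_count_ge0 A t) => [r| |]//.
  rewrite lee_fin lte_fin => r0 rk; have /andP[ir ri] := truncn_itv r0.
  set i := Num.trunc r in ir ri.
  have iE : eigenvalue_count A t = i%:R%:E.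
    by apply/eqP; rewrite eq_le {2}E lee_fin ir andbT eigenvalue_count_nat// E lte_fin.
  have ik : (i <= k)%N by rewrite -(ler_nat R); exact: le_trans ir (ltW rk).
  exists i; split => //.
  move: kt; rewrite iE natrB// EFinB => kt.
  by rewrite leeBlDl.
have : (t%:E < m i)%E.
  apply: (lt_le_trans tM).
  exact: (@bigmin_le_cond _ _ _ _ (Ordinal (ik : (i < k.+1)%N)) _ (fun i : 'I_k.+1 => m i)).
rewrite ltNge => /negP; apply.
by rewrite ge_max !lambda_le.
Qed.

(** * Positivity of the eigenvalues *)

Lemma dnbhs0_right (R : realType) (P : R -> Prop) :
  (\forall h \near (0 : R)^', P h) ->
  exists2 d, 0 < d & forall h, 0 < h -> h < d -> P h.
Proof.
rewrite /dnbhs /within/= => /nbhs_ballP[d d0 dP]; exists d => // h h0 hd.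
by apply: dP; rewrite ?gt_eqF// -ball_normE/= sub0r normrN gtr0_norm.
Qed.

(** If [d > 0], then [f1], which vanishes at the maximum 0, is positive just to
    the right of it, and [f] increases there by the mean value theorem. *)
Lemma second_derivative_at_max (R : realType) (f f1 : R -> R) (d r : R) :
  0 < r -> (forall s : R, `|s| < r -> is_derive s 1 f (f1 s)) ->
  is_derive (0 : R) 1 f1 d -> (forall s, `|s| < r -> f s <= f 0) -> d <= 0.
Proof.
move=> r0 df df1 fmax; rewrite leNgt; apply/negP => d0.
have f10 : f1 0 = 0.
  have m0 : (0 : R) \in `]-r, r[ by rewrite in_itv/= oppr_lt0 r0.
  have [_ Df0] : is_derive (0 : R) 1 f 0.
    apply: (derive1_at_max _ _ m0).
    - by rewrite ge0_cp// ltW.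
    - by move=> t; rewrite in_itv/= -ltr_norml => /df[].
    - by move=> t; rewrite in_itv/= -ltr_norml => /fmax.
  have f0 : is_derive (0 : R) 1 f (f1 0) by apply: df; rewrite normr0.
  by have [_ Df0'] := f0; rewrite -Df0' Df0.
have [t t0 tpos] : exists2 d : R, 0 < d & forall s, 0 < s -> s < d -> 0 < f1 s.
  have [dv f1E] := df1; rewrite -f1E in d0.
  have quot : h^-1 *: (f1 (h *: 1 + 0) - f1 0)
    @[h --> 0^'] --> 'D_1 f1 0 by exact: dv.
  have [t t0 tP] := dnbhs0_right (cvgr_gt _ quot _ d0).
  exists t => // s s0 st; have := tP s s0 st.
  by rewrite f10 subr0 addr0 [s *: 1]mulr1 /GRing.scale/= pmulr_rgt0// invr_gt0.
pose s := Num.min t r / 2.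
have m0 : 0 < Num.min t r by rewrite lt_min t0.
have s0 : 0 < s by rewrite divr_gt0.
have sm : s < Num.min t r by rewrite ltr_pdivrMr// ltr_pMr// ltr1n.
have [st sr] : s < t /\ s < r by move: sm; rewrite lt_min => /andP.
have lts x : 0 <= x <= s -> `|x| < r.
  by move=> /andP[x0 xs]; rewrite ger0_norm//; exact: le_lt_trans sr.
have [||c] := @MVT _ f f1 0 s s0.
- by move=> x; rewrite in_itv/= => /andP[/ltW x0 /ltW xs]; apply: df; rewrite lts// x0.
- apply: derivable_within_continuous => x; rewrite in_itv/= => xs.
  by have [] := df x (lts x xs).
rewrite in_itv/= subr0 => /andP[c0 cs] fs.
have : 0 < f s - f 0 by rewrite fs mulr_gt0// tpos//; exact: lt_trans cs st.
by rewrite subr_gt0 ltNge fmax// lts// lexx ltW.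
Qed.

Lemma is_derive_line (R : realType) (n : nat) (v : 'rV[R]_n -> R)
    (x e : 'rV[R]_n) (t : R) : derivable v (x + t *: e) e ->
  is_derive t 1 (fun s => v (x + s *: e)) ('D_e v (x + t *: e)).
Proof.
pose f s := v (x + s *: e).
have fE : (fun h => h^-1 *: (f (h *: 1 + t) - f t)) =
    (fun h => h^-1 *: (v (h *: e + (x + t *: e)) - v (x + t *: e))).
  by apply/funext => h; rewrite /f [h *: 1]mulr1 scalerDl addrCA.
by move=> dv; split; [rewrite /derivable fE|rewrite /derive fE].
Qed.

Lemma local_max_partial2_le0 (R : realType) (n : nat) (U : set 'rV[R]_n)
    (v : 'rV[R]_n -> R) (x : 'rV[R]_n) (i : 'I_n) : open U -> C2_on U v ->
  U x -> (forall y, U y -> v y <= v x) -> partial i (partial i v) x <= 0.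
Proof.
move=> oU [C1v C2v] Ux vmax.
set e : 'rV[R]_n := delta_mx 0 i.
have [r r0 Uline] : exists2 r : R, 0 < r & forall s, `|s| < r -> U (x + s *: e).
  have cl : (fun s : R => x + s *: e) @ (0 : R) --> x + 0 *: e.
    exact: (cvgD (cvg_cst x) (cvgZr_tmp (a := e) (@cvg_id _ (nbhs (0 : R))))).
  have : nbhs (x + 0 *: e) U by rewrite scale0r addr0; exact: open_nbhs_nbhs.
  move=> /cl/nbhs_ballP[d d0' dU]; exists d => // s sd; apply: dU.
  by rewrite -ball_normE/= sub0r normrN.
apply: (@second_derivative_at_max _ (fun s => v (x + s *: e))
  (fun s => partial i v (x + s *: e)) _ r r0).
- by move=> s /Uline Us; apply: is_derive_line; have [] := C1v _ Us i.
- have := @is_derive_line _ _ (partial i v) x e 0.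
  rewrite scale0r addr0; apply.
  by have [] := C2v i x Ux i.
- by move=> s /Uline Us; rewrite scale0r addr0; exact: vmax.
Qed.

Lemma coord_le_norm (R : realType) (n : nat) (x : 'rV[R]_n) (i : 'I_n) :
  `|x 0 i| <= `|x|.
Proof.
rewrite [leRHS]mx_normrE.
exact: (le_bigmax _ (fun ij : 'I_1 * 'I_n => `|x ij.1 ij.2|) (0, i)).
Qed.

Lemma is_derive_stationary (R : realType) (n : nat) (q : 'rV[R]_n -> R)
    (x e : 'rV[R]_n) : (forall h : R, q (h *: e + x) = q x) -> is_derive x e q 0.
Proof.
move=> qE; have quotE : (fun h : R => h^-1 *: ((q \o shift x) (h *: e) - q x)) = cst 0.
  by apply/funext => h; rewrite /= qE subrr scaler0.
split; rewrite /derivable /derive quotE; first exact: is_cvg_cst.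
exact: lim_cst.
Qed.

Lemma continuous_mul (R : realType) (T : topologicalType) (f g : T -> R) :
  continuous f -> continuous g -> continuous (fun x => f x * g x).
Proof. by move=> cf cg x; exact: (cvgM (cf x) (cg x)). Qed.

Lemma continuous_opp (R : realType) (T : topologicalType) (f : T -> R) :
  continuous f -> continuous (fun x => - f x).
Proof. by move=> cf x; exact: (cvgN (cf x)). Qed.

Lemma continuous_add (R : realType) (T : topologicalType) (f g : T -> R) :
  continuous f -> continuous g -> continuous (fun x => f x + g x).
Proof. by move=> cf cg x; exact: (cvgD (cf x) (cg x)). Qed.

Lemma is_derive_comp_coord (R : realType) (n : nat) (g : R -> R) (x : 'rV[R]_n)
    (i j : 'I_n) (dg : R) : is_derive (x 0 i) 1 g dg ->
  is_derive x (delta_mx 0 j) (fun y => g (y 0 i)) ((i == j)%:R * dg).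
Proof.
have [<-|ij] := eqVneq i j => gd; last first.
  rewrite mul0r; apply: is_derive_stationary => h.
  by rewrite !mxE eqxx/= (negbTE ij) mulr0 add0r.
have quotE : (fun h : R => h^-1 *: (((fun y : 'rV_n => g (y 0 i)) \o shift x)
      (h *: delta_mx 0 i) - g (x 0 i))) =
    (fun h => h^-1 *: ((g \o shift (x 0 i)) (h *: 1) - g (x 0 i))).
  by apply/funext => h; rewrite /= !mxE !eqxx.
by have [gd1 gd2] := gd; split; rewrite /derivable /derive quotE ?mul1r.
Qed.

Lemma C1_on_is_derive (R : realType) (n : nat) (U : set 'rV[R]_n)
    (u : 'rV[R]_n -> R) (du : 'I_n -> 'rV[R]_n -> R) :
  (forall x i, is_derive x (delta_mx 0 i) u (du i x)) ->
  (forall i, continuous (du i)) ->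
  C1_on U u /\ forall i, partial i u = du i.
Proof.
move=> ud cdu; have pE i : partial i u = du i.
  by apply/funext => x; have [_ <-] := ud x i.
split=> // x _ i; split; first by have [] := ud x i.
by rewrite pE; exact: cdu.
Qed.

Lemma paraboloid_C2 (R : realType) (n : nat) (U : set 'rV[R]_n) (i : 'I_n)
    (C : R) : let w := fun x : 'rV[R]_n => C - x 0 i ^+ 2 in
  C2_on U w /\ forall x, laplacian w x = - 2.
Proof.
move=> w.
have cc : continuous (fun x : 'rV[R]_n => x 0 i) by exact: coord_continuous.
have [] := @C1_on_is_derive _ _ U w (fun j x => (i == j)%:R * (- (2 * x 0 i))).
- move=> x j; apply: (@is_derive_comp_coord _ _ (fun t => C - t ^+ 2)).
  by apply: is_derive_eq; rewrite /= /GRing.scale/=; ring.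
- move=> j; apply: continuous_mul; first exact: cst_continuous.
  by apply: continuous_opp; apply: continuous_mul => //; exact: cst_continuous.
move=> C1w pw.
have p2 j : C1_on U (partial j w) /\
    forall k, partial k (partial j w) = fun=> (i == k)%:R * ((i == j)%:R * (- 2)).
  rewrite pw; apply: C1_on_is_derive => [x k|k]; last exact: cst_continuous.
  apply: (@is_derive_comp_coord _ _ (fun t => (i == j)%:R * (- (2 * t)))).
  by apply: is_derive_eq; rewrite /GRing.scale/=; ring.
split; first by split; [exact: C1w|move=> j; have [] := p2 j].
move=> x; rewrite /laplacian (bigD1 i)//= big1 => [|j ji].
  by have [_ ->] := p2 i; rewrite eqxx !mul1r addr0.
by have [_ ->] := p2 j; rewrite eq_sym (negbTE ji) mul0r.
Qed.

(** The maximum principle. Compare an eigenfunction [u] with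
    [w x = C - (x 0 i) ^+ 2], which is positive on the bounded set and satisfies
    [- laplacian w = 2]. Where [u / w] attains its positive maximum [q], the
    function [u - q * w] has an interior maximum, hence a nonpositive Laplacian,
    that is [mu * q * w >= 2 * q], and [w <= C]. *)
Lemma eigenvalue_lower_bound (R : realType) (n : nat) (W : set 'rV[R]_n) :
  (0 < n)%N -> bounded_set W -> open W ->
  exists2 c : R, 0 < c & forall mu u, dirichlet_eigenfunction W mu u ->
    mu < c -> forall x, u x = 0.
Proof.
case: n W => // n W _ bW oW.
have [M [M0 WM]] : exists M, 0 < M /\ forall x, closure W x -> `|x| <= M.
  have [M [_ /(_ (`|M| + 1))bM]] := bW.
  have WM x : W x -> `|x| <= `|M| + 1 by apply: bM; rewrite (le_lt_trans (ler_norm _))// ltrDl.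
  exists (`|M| + 1); split; first by rewrite ltr_wpDl.
  move=> x cWx; rewrite leNgt; apply/negP => Mx.
  have e0 : 0 < `|x| - (`|M| + 1) by rewrite subr_gt0.
  have [y [Wy]] := cWx _ (nbhsx_ballx x _ e0).
  rewrite -ball_normE/= ltrBrDr => xy.
  have : `|x| <= `|x - y| + `|y| by rewrite -{1}(subrK y x) ler_normD.
  rewrite leNgt => /negP; apply; apply: le_lt_trans xy.
  by rewrite lerD2l WM.
pose C := M ^+ 2 + 1; pose w := fun x : 'rV[R]_n.+1 => C - x 0 ord0 ^+ 2.
have C0 : 0 < C by rewrite ltr_wpDl// sqr_ge0.
have [C2w lw] : C2_on W w /\ forall x, laplacian w x = - 2 := paraboloid_C2 W ord0 C.
have cw : continuous w.
  have cc : continuous (fun x : 'rV[R]_n.+1 => x 0 ord0) by exact: coord_continuous.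
  have -> : w = fun x => C - x 0 ord0 * x 0 ord0.
    by apply/funext => x; rewrite /w expr2.
  apply: continuous_add; first exact: cst_continuous.
  by apply: continuous_opp; exact: continuous_mul.
have w1 x : closure W x -> 1 <= w x.
  move=> /WM/(le_trans (coord_le_norm x ord0)); rewrite ler_norml => /andP[xM1 xM2].
  by rewrite /w /C; nra.
have wC x : w x <= C by rewrite /w gerBl sqr_ge0.
exists (2 / C); first by rewrite divr_gt0.
suff pos mu u x1 : dirichlet_eigenfunction W mu u -> mu < 2 / C -> u x1 <= 0.
  move=> mu u eu muC x; apply/eqP; rewrite eq_le (pos mu u x eu muC)/=.
  have eNu : dirichlet_eigenfunction W mu (fun y => -1 * u y + 0).
    exact: (eigenfunction_lin (-1) oW eu (eigenfunction0 W mu)).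
  by have := pos mu _ x eNu muC; rewrite addr0 mulN1r oppr_le0.
move=> eu muC; rewrite leNgt; apply/negP => ux1.
have [C2u cu u0 eqn] := (eigenfunctionP mu u oW).1 eu.
have Wpos x : 0 < u x -> W x.
  by move=> ux; apply: contrapT => /u0 ux0; rewrite ux0 ltxx in ux.
have KW : compact (closure W).
  apply: bounded_closed_compact; last exact: closed_closure.
  exists M; split; first exact: num_real.
  by move=> N MN x /WM xM; exact: le_trans xM (ltW MN).
have cq : {within closure W, continuous (fun x => u x / w x)}.
  apply/subspace_continuousP => x cWx; apply: cvg_within_filter.
  apply: (cvgM (cu x)); apply: (cvgV _ (cw x)).
  by rewrite gt_eqF// (lt_le_trans ltr01 (w1 x cWx)).
have [z] := compact_EVT_max (ex_intro _ x1 (@subset_closure _ W x1 (Wpos x1 ux1))) KW cq.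
rewrite inE => cWz qmax; set q := u z / w z in qmax.
have wz := w1 z cWz; have wz0 : 0 < w z by exact: lt_le_trans wz.
have q0 : 0 < q.
  have := qmax x1; rewrite inE => /(_ (@subset_closure _ W x1 (Wpos x1 ux1))).
  apply: lt_le_trans; rewrite divr_gt0// (lt_le_trans ltr01)// w1//.
  exact/subset_closure/Wpos.
have uz : u z = q * w z by rewrite divfK// gt_eqF.
have Wz : W z by apply: Wpos; rewrite uz mulr_gt0.
have C2v := C2_on_lin (- q) oW C2w C2u.
have vle y : W y -> - q * w y + u y <= - q * w z + u z.
  move=> Wy; have cWy := @subset_closure _ W y Wy.
  have := qmax y; rewrite inE => /(_ cWy); rewrite ler_pdivrMr; last first.
    exact: lt_le_trans (w1 y cWy).
  by move=> uqw; rewrite uz !mulNr addNr addrC subr_le0.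
have : laplacian (fun y => - q * w y + u y) z <= 0.
  by apply: sumr_le0 => i _; exact: local_max_partial2_le0 vle.
rewrite (laplacian_lin (- q) oW C2w C2u Wz) lw.
have := eqn z Wz; move: (laplacian u z) => lu; rewrite uz => lE.
have wzC : mu * w z < 2.
  have [mu0|mu0] := leP mu 0; first exact: le_lt_trans (mulr_le0_ge0 mu0 (ltW wz0)) (ltr0Sn R 1).
  apply: (@le_lt_trans _ _ (mu * C)); first by rewrite ler_pM2l// wC.
  by rewrite -ltr_pdivlMr.
have : 0 < q * (2 - mu * w z) by rewrite mulr_gt0// subr_gt0.
by rewrite (_ : q * (2 - mu * w z) = - q * - 2 + lu) ?ltNge; [move=> /negP|lra].
Qed.

Lemma lambda_gt0 (R : realType) (n k : nat) (W : set 'rV[R]_n) :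
  (0 < n)%N -> (0 < k)%N -> bounded_set W -> open W -> (0 < lambda k W)%E.
Proof.
move=> n0 k0 bW oW; have [c c0 cW] := eigenvalue_lower_bound n0 bW oW.
apply: (@lt_le_trans _ _ c%:E); first by rewrite lte_fin.
apply: le_ereal_inf_tmp => _ [t kt <-]; rewrite lee_fin leNgt; apply/negP => tc.
move: kt; rewrite /= /eigenvalue_count esum1 ?lee_fin => [|mu /= mut].
  by rewrite leNgt ltr0n k0.
apply/eqP; rewrite eq_le multiplicity_ge0 andbT.
apply: ge_ereal_sup => _ [[|m] [u [eu iu]] <-]//.
have u0 j x : u j x = 0 by apply: cW (eu j) _ x; exact: le_lt_trans mut tc.
have /eqP : (1 : R) = 0.
  by apply: (iu (fun=> 1) _ ord0) => x; rewrite big1// => j _; rewrite u0 mulr0.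
by rewrite oner_eq0.
Qed.

(** * Similarities *)

(** The image of [W] under the inverse of the similarity [x |-> s *: x + c]. *)
Definition similar_set (R : realType) (n : nat) (s : R) (c : 'rV[R]_n)
  (W : set 'rV[R]_n) : set 'rV[R]_n := [set x | W (s *: x + c)].

Lemma similarity_continuous (R : realType) (n : nat) (s : R) (c : 'rV[R]_n) :
  continuous (fun x : 'rV[R]_n => s *: x + c).
Proof.
move=> x; have h : (s *: x0) @[x0 --> x] --> s *: x by exact: scaler_continuous.
exact: (cvgD h (cvg_cst c)).
Qed.

Lemma similar_setK (R : realType) (n : nat) (s : R) (c : 'rV[R]_n)
    (W : set 'rV[R]_n) : 0 < s ->
  similar_set s^-1 (- s^-1 *: c) (similar_set s c W) = W.
Proof.
move=> s0; rewrite /similar_set; apply/funext => x /=.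
by rewrite scaleNr -scalerBr scalerA divff ?gt_eqF// scale1r subrK.
Qed.

Lemma open_similar_set (R : realType) (n : nat) (s : R) (c : 'rV[R]_n)
    (W : set 'rV[R]_n) : open W -> open (similar_set s c W).
Proof. by move=> oW; apply: open_comp oW => x _; exact: similarity_continuous. Qed.

Arguments open_similar_set {R n} s c {W}.

Lemma is_derive_of_line (R : realType) (n : nat) (v : 'rV[R]_n -> R)
    (x e : 'rV[R]_n) (d : R) :
  is_derive (0 : R) 1 (fun t => v (x + t *: e)) d -> is_derive x e v d.
Proof.
have quotE : (fun h : R => h^-1 *: ((v \o shift x) (h *: e) - v x)) =
    (fun h => h^-1 *: (((fun t => v (x + t *: e)) \o shift 0) (h *: 1) -
                       v (x + 0 *: e))).
  by apply/funext => h; rewrite /= scale0r !addr0 [h *: 1]mulr1 [x + _]addrC.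
by move=> [d1 d2]; split; rewrite /derivable /derive quotE.
Qed.

Lemma is_derive_similarity (R : realType) (n : nat) (u : 'rV[R]_n -> R) (s : R)
    (c x e : 'rV[R]_n) : derivable u (s *: x + c) e ->
  is_derive x e (fun y => u (s *: y + c)) (s * 'D_e u (s *: x + c)).
Proof.
move=> du; apply: is_derive_of_line.
have gd : is_derive (s * 0) 1 (fun t => u (s *: x + c + t *: e)) ('D_e u (s *: x + c)).
  have := @is_derive_line _ _ u (s *: x + c) e 0.
  by rewrite mulr0 scale0r addr0; apply.
have sd : is_derive (0 : R) 1 (fun t => s * t) s.
  by apply: is_derive_eq; rewrite /GRing.scale/=; ring.
have := is_derive1_comp gd sd; rewrite mulrC.
congr is_derive; apply/funext => t /=.
by rewrite scalerDr scalerA addrAC.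
Qed.

Lemma C1_on_similarity (R : realType) (n : nat) (W : set 'rV[R]_n)
    (u : 'rV[R]_n -> R) (s : R) (c : 'rV[R]_n) : open W -> C1_on W u ->
  C1_on (similar_set s c W) (fun y => u (s *: y + c)) /\
  forall i x, similar_set s c W x ->
    partial i (fun y => u (s *: y + c)) x = s * partial i u (s *: x + c).
Proof.
move=> oW C1u.
have pE i x : similar_set s c W x ->
    partial i (fun y => u (s *: y + c)) x = s * partial i u (s *: x + c).
  by move=> /C1u/(_ i)[du _]; have [_] := is_derive_similarity du.
split => // x Wx i; have [du cu] := C1u _ Wx i.
split; first by have [] := is_derive_similarity du.
have pnear : \near x, s * partial i u (s *: x + c) =
    partial i (fun y => u (s *: y + c)) x.
  near=> y; rewrite pE//; near: y.
  by apply: open_nbhs_nbhs; split => //; exact: open_similar_set.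
have plim : (fun y => s * partial i u (s *: y + c)) @ x -->
    s * partial i u (s *: x + c).
  have h : partial i u (s *: y + c) @[y --> x] --> partial i u (s *: x + c).
    exact: (cvg_comp _ _ (@similarity_continuous _ _ s c x) cu).
  exact: (cvgM (cvg_cst s) h).
by have := near_cvg_eq pnear plim; rewrite -(pE i x Wx).
Unshelve. all: by end_near. Qed.

Arguments C1_on_similarity {R n W u} s c.

Lemma C2_on_similarity (R : realType) (n : nat) (W : set 'rV[R]_n)
    (u : 'rV[R]_n -> R) (s : R) (c : 'rV[R]_n) : open W -> C2_on W u ->
  C2_on (similar_set s c W) (fun y => u (s *: y + c)) /\
  forall x, similar_set s c W x ->
    laplacian (fun y => u (s *: y + c)) x = s ^+ 2 * laplacian u (s *: x + c).
Proof.
move=> oW [C1u C2u]; have oW' := open_similar_set s c oW.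
have [C1v vE] := C1_on_similarity s c oW C1u.
have C10 : C1_on (similar_set s c W) (fun=> 0 : R).
  by have [[]] := eigenfunction0 (similar_set s c W) 0.
have vE' i x : similar_set s c W x -> s * partial i u (s *: x + c) + 0 =
    partial i (fun y => u (s *: y + c)) x.
  by move=> Wx; rewrite addr0 vE.
split.
  split; first exact: C1v.
  move=> i; apply: (C1_on_eq oW' (vE' i)).
  exact: (C1_on_lin s oW' (C1_on_similarity s c oW (C2u i)).1 C10).
move=> x Wx; rewrite /laplacian mulr_sumr; apply: eq_bigr => i _.
rewrite -(partial_eq i oW' (vE' i) Wx).
have [C1p pE] := C1_on_similarity s c oW (C2u i).
rewrite (partial_lin s i C1p C10 Wx) pE//.
rewrite [X in _ + X](_ : _ = 0) ?addr0 ?expr2 ?mulrA//.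
exact: derive_cst.
Qed.

Arguments C2_on_similarity {R n W u} s c.

Lemma eigenfunction_similarity (R : realType) (n : nat) (W : set 'rV[R]_n)
    (mu : R) (u : 'rV[R]_n -> R) (s : R) (c : 'rV[R]_n) : open W ->
  dirichlet_eigenfunction W mu u ->
  dirichlet_eigenfunction (similar_set s c W) (s ^+ 2 * mu)
    (fun y => u (s *: y + c)).
Proof.
move=> oW /(eigenfunctionP mu u oW)[C2u cu u0 eu].
have [C2v vE] := C2_on_similarity s c oW C2u.
apply: (eigenfunctionP _ _ (open_similar_set s c oW)).2; split.
- exact: C2v.
- move=> x; exact: (cvg_comp _ _ (@similarity_continuous _ _ s c x) (cu _)).
- by move=> x; exact: u0.
- by move=> x Wx; rewrite (vE x Wx) -mulrN (eu _ Wx) mulrA.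
Qed.

Lemma multiplicity_similar_set (R : realType) (n : nat) (W : set 'rV[R]_n)
    (mu s : R) (c : 'rV[R]_n) : open W -> 0 < s ->
  (multiplicity W mu <= multiplicity (similar_set s c W) (s ^+ 2 * mu))%E.
Proof.
move=> oW s0; apply: ge_ereal_sup => _ [m [u [eu iu]] <-].
apply: (@multiplicity_ge _ _ _ _ _ (fun j y => u j (s *: y + c))).
  by move=> j; exact: eigenfunction_similarity.
move=> a aE; apply: iu => x; rewrite -[RHS](aE (s^-1 *: (x - c))).
by apply: eq_bigr => j _; rewrite scalerA divff ?gt_eqF// scale1r subrK.
Qed.

Lemma lambda_similar_set (R : realType) (n k : nat) (W : set 'rV[R]_n)
    (s : R) (c : 'rV[R]_n) : open W -> 0 < s ->
  (lambda k (similar_set s c W) <= (s ^+ 2)%:E * lambda k W)%E.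
Proof.
move=> oW s0; have s20 : 0 < s ^+ 2 by rewrite exprn_gt0.
rewrite {2}/lambda -ereal_inf_pZl//.
apply: le_ereal_inf_tmp => _ [_ [t kt <-] <-]; rewrite -EFinM.
apply: lambda_le; apply: (le_trans kt).
rewrite /eigenvalue_count (reindex_esum [set mu | mu <= t] [set mu | mu <= s ^+ 2 * t]
  (fun mu => s ^+ 2 * mu)).
  by apply: le_esum => mu _; exact: multiplicity_similar_set.
split.
- by move=> mu /= mut; rewrite ler_pM2l.
- by move=> x y _ _; apply: mulfI; rewrite gt_eqF.
- move=> y /= yt; exists (y / s ^+ 2); last by rewrite mulrC divfK ?gt_eqF.
  by rewrite /= ler_pdivrMr// mulrC.
Qed.

(** * Domains *)

Lemma lipschitzP (R : realType) (n : nat) (g : 'rV[R]_n -> R) :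
  lipschitz g <-> exists M, forall x y, `|g x - g y| <= M * `|x - y|.
Proof.
split.
  move=> [M [_ Mg]]; exists (M + 1) => x y.
  by have := Mg (M + 1); rewrite ltrDl ltr01 => /(_ isT (x, y)); apply; split.
move=> [M Mg]; exists M; split; first exact: num_real.
move=> N MN [x y] _ /=; apply: (le_trans (Mg x y)).
by rewrite ler_wpM2r// ltW.
Qed.

Lemma dotDl (R : realType) (n : nat) (x y v : 'rV[R]_n) :
  dot (x + y) v = dot x v + dot y v.
Proof. by rewrite /dot -big_split/=; apply: eq_bigr => i _; rewrite mxE mulrDl. Qed.

Lemma dotZl (R : realType) (n : nat) (a : R) (x v : 'rV[R]_n) :
  dot (a *: x) v = a * dot x v.
Proof. by rewrite /dot mulr_sumr; apply: eq_bigr => i _; rewrite mxE mulrA. Qed.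

(** The same direction [v] serves at corresponding boundary points; the function
    whose graph is the boundary is transported by the similarity that [x |-> s *: x + c]
    induces on the hyperplane orthogonal to [v]. *)
Lemma domain_similar_set (R : realType) (n : nat) (W : set 'rV[R]_n) (s : R)
    (c : 'rV[R]_n) : 0 < s -> domain W -> domain (similar_set s c W).
Proof.
move=> s0 [bW oW lW]; have oW' := open_similar_set s c oW; split => //.
  have [M [_ bM]] := bW; exists (s^-1 * (M + 1 + `|c|)); split; first exact: num_real.
  move=> N MN x Wx; apply: le_trans (ltW MN).
  have -> : x = s^-1 *: ((s *: x + c) - c).
    by rewrite addrK scalerA mulVf ?gt_eqF// scale1r.
  rewrite normrZ gtr0_norm ?invr_gt0// ler_pM2l ?invr_gt0//.
  apply: (le_trans (ler_normB _ _)); rewrite lerD2r.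
  by apply: (bM (M + 1)); rewrite ?ltrDl.
move=> p [cp ip]; set q := s *: p + c.
have cq : closure W q.
  move=> N Nq; have [y [Wy Ny]] := cp _ (@similarity_continuous _ _ s c p N Nq).
  by exists (s *: y + c).
have iq : ~ interior W q by rewrite (interior_id _).1// => Wq; apply: ip; rewrite (interior_id _).1.
have [v [g [vv lg Wg]]] := lW q (conj cq iq).
exists v, (fun y => s^-1 * (g (s *: y + (c - dot c v *: v)) - dot c v)).
split => //.
  have [M Mg] := (lipschitzP g).1 lg; apply/lipschitzP; exists M => x y.
  rewrite -mulrBr normrM gtr0_norm ?invr_gt0// ler_pdivrMl//.
  rewrite opprB addrA subrK; apply: (le_trans (Mg _ _)).
  rewrite opprD addrACA subrr addr0 -scalerBr normrZ gtr0_norm//.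
  by rewrite mulrCA.
have Wg' : \forall x \near p, W (s *: x + c) <->
    g (s *: x + c - dot (s *: x + c) v *: v) < dot (s *: x + c) v.
  exact: (@similarity_continuous _ _ s c p _ Wg).
apply: filterS Wg' => x Wx.
rewrite ltr_pdivrMl// ltrBlDr -dotZl -dotDl.
suff -> : s *: (x - dot x v *: v) + (c - dot c v *: v) =
    s *: x + c - dot (s *: x + c) v *: v by [].
by rewrite dotDl dotZl scalerDl scalerBr scalerA opprD addrACA.
Qed.

(** A slab between the two sets keeps each away from the boundary of the other.
    Mere disjointness would not suffice: two domains may touch. *)
Lemma domain_setU (R : realType) (n : nat) (A B : set 'rV[R]_n) (i : 'I_n) (a b : R) :
  a < b -> (forall x, A x -> x 0 i <= a) -> (forall x, B x -> b <= x 0 i) ->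
  domain A -> domain B -> domain (A `|` B).
Proof.
move=> ab Aa Bb [bA oA lA] [bB oB lB].
have cc : continuous (fun x : 'rV[R]_n => x 0 i) by exact: coord_continuous.
have cA (x : 'rV[R]_n) : closure A x -> x 0 i <= a.
  move=> cAx; rewrite leNgt; apply/negP => ax.
  have ay : \forall y \near x, a < (y : 'rV[R]_n) 0 i by exact: (cvgr_gt _ (cc x) _ ax).
  by have [y [/Aa + ay']] := cAx _ ay; rewrite leNgt ay'.
have cB (x : 'rV[R]_n) : closure B x -> b <= x 0 i.
  move=> cBx; rewrite leNgt; apply/negP => bx.
  have by_ : \forall y \near x, (y : 'rV[R]_n) 0 i < b by exact: (cvgr_lt _ (cc x) _ bx).
  by have [y [/Bb + by']] := cBx _ by_; rewrite leNgt by'.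
split; [|exact: openU|].
  have [[M [_ MA]] [N [_ NB]]] := (bA, bB).
  exists (Num.max M N); split; first exact: num_real.
  by move=> r; rewrite gt_max => /andP[Mr Nr] x [|]; [exact: MA|exact: NB].
move=> p [+ ip]; rewrite closureU => -[cAp|cBp].
  have [|v [g [vv lg Ag]]] := lA p.
    split => // iA; apply: ip; exact: (@interiorU _ A B p (or_introl iA)).
  exists v, g; split => //.
  have nB : \forall x \near p, (x : 'rV[R]_n) 0 i < b.
    exact: (cvgr_lt _ (cc p) _ (le_lt_trans (cA p cAp) ab)).
  apply: filterS2 Ag nB => x Agx xb; rewrite -Agx; split; last by left.
  by move=> [//|/Bb]; rewrite leNgt xb.
have [|v [g [vv lg Bg]]] := lB p.
  split => // iB; apply: ip; exact: (@interiorU _ A B p (or_intror iB)).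
exists v, g; split => //.
have nA : \forall x \near p, a < (x : 'rV[R]_n) 0 i.
  exact: (cvgr_gt _ (cc p) _ (lt_le_trans ab (cB p cBp))).
apply: filterS2 Bg nA => x Bgx xa; rewrite -Bgx; split; last by right.
by move=> [/Aa|//]; rewrite leNgt xa.
Qed.

(** * The cube *)

(** The norm of a row vector is the maximum of the absolute values of its
    coordinates, so this open ball is the cube of side [2 * h]. *)
Definition cube (R : realType) (n : nat) (h : R) : set 'rV[R]_n :=
  [set x | `|x| < h].

Lemma norm_lt_coord (R : realType) (n : nat) (x : 'rV[R]_n) (h : R) :
  0 < h -> (forall i, `|x 0 i| < h) -> `|x| < h.
Proof.
move=> h0 xh; rewrite [ltLHS]mx_normrE; apply/bigmax_ltP; split => // -[i j] _ /=.
by rewrite (ord1 i).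
Qed.

Lemma open_cube (R : realType) (n : nat) (h : R) : open (@cube R n h).
Proof.
apply: (@open_comp _ _ (fun x : 'rV[R]_n => `|x|) [set y | y < h]).
  by move=> x _; exact: norm_continuous.
exact: open_lt.
Qed.

Lemma closure_cube (R : realType) (n : nat) (h : R) (x : 'rV[R]_n) :
  closure (@cube R n h) x -> `|x| <= h.
Proof.
move=> cx; rewrite leNgt; apply/negP => hx.
have hy : \forall y \near x, h < `|y : 'rV[R]_n|.
  exact: (cvgr_gt _ (@norm_continuous _ _ x) _ hx).
by have [y [yh hy']] := cx _ hy; move: yh; rewrite /cube/= ltNge ltW.
Qed.

Lemma lipschitz_bigmax (R : realType) (n : nat) (M : R)
    (g : 'I_n.+1 -> 'rV[R]_n.+1 -> R) :
  (forall i x y, `|g i x - g i y| <= M * `|x - y|) ->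
  lipschitz (fun x => \big[Num.max/g ord0 x]_i g i x).
Proof.
move=> gM; apply/lipschitzP; exists M.
suff h x y : \big[Num.max/g ord0 x]_i g i x <=
    M * `|x - y| + \big[Num.max/g ord0 y]_i g i y.
  by move=> x y; rewrite ler_norml lerBlDr h andbT lerNl opprB lerBlDr distrC h.
have gi i : g i x <= M * `|x - y| + \big[Num.max/g ord0 y]_i g i y.
  rewrite -(subrK (g i y) (g i x)); apply: lerD; last exact: le_bigmax.
  exact: le_trans (ler_norm _) (gM i x y).
by apply: bigmax_le => // i _.
Qed.

(** Near a point of the closed cube lying in the orthant of signs [sg], the cube
    is the set where [sg i * x 0 i < h] for all [i], which is the region above
    the graph of a maximum of affine functions in the direction of [- sg]. *)
Lemma domain_cube (R : realType) (n : nat) (h : R) : (0 < n)%N -> 0 < h ->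
  domain (@cube R n h).
Proof.
case: n => // n _ h0; split; last 1 [|exact: open_cube|].
- exists h; split; first exact: num_real.
  by move=> M hM x xh; apply: ltW; exact: lt_trans xh hM.
move=> p [/closure_cube ph _].
pose sg i : R := if 0 <= p 0 i then 1 else -1.
have sg2 i : sg i * sg i = 1 by rewrite /sg; case: ifP => _; rewrite ?mulr1// mulrNN mulr1.
have sgn i a : `|sg i * a| = `|a|.
  by rewrite normrM /sg; case: ifP => _; rewrite ?normrN normr1 mul1r.
have sgp i : 0 <= sg i * p 0 i.
  rewrite /sg; case: (leP 0 (p 0 i)) => pi; rewrite ?mul1r// mulN1r oppr_ge0.
  exact: ltW.
pose q : R := Num.sqrt n.+1%:R.
have q0 : 0 < q by rewrite sqrtr_gt0 ltr0n.
have q2 : q * q = n.+1%:R by rewrite -expr2 sqr_sqrtr// ler0n.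
pose v : 'rV[R]_n.+1 := \row_i - (sg i / q).
exists v, (fun y => \big[Num.max/q * (sg ord0 * y 0 ord0 - h)]_i (q * (sg i * y 0 i - h))).
split.
- rewrite /dot (eq_bigr (fun=> (q * q)^-1)) => [|i _].
    by rewrite sumr_const card_ord q2 -[RHS](@mulVf _ (n.+1%:R : R)) ?mulr_natr// pnatr_eq0.
  by rewrite !mxE mulrNN mulrACA sg2 mul1r invfM.
- apply: (@lipschitz_bigmax _ _ q (fun i y => q * (sg i * y 0 i - h))) => i x y.
  rewrite -mulrBr normrM gtr0_norm// ler_pM2l// opprB addrA subrK -mulrBr sgn.
  by have := coord_le_norm (x - y) i; rewrite !mxE.
have : nbhs p (ball p h) by exact: nbhsx_ballx.
apply: filterS => x; rewrite -ball_normE/= => pxh.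
set t := dot x v.
have lower i : - h < sg i * x 0 i.
  have := le_lt_trans (coord_le_norm (p - x) i) pxh.
  rewrite !mxE -(sgn i) ltr_norml mulrBr => /andP[_].
  by rewrite ltrBlDr => /(le_lt_trans (sgp i)); rewrite -subr_lt0 sub0r opprD; lra.
have gE i : (q * (sg i * (x - t *: v) 0 i - h) < t) = (sg i * x 0 i < h).
  rewrite !mxE (_ : q * _ = q * (sg i * x 0 i - h) + t * (sg i * sg i)); last first.
    by field; rewrite gt_eqF.
  by rewrite sg2 mulr1 gtrDr pmulr_rlt0// subr_lt0.
split=> [xh|/bigmax_ltP[_ gt]].
  have xi i : sg i * x 0 i < h.
    by apply: le_lt_trans (ler_norm _) _; rewrite sgn; exact: le_lt_trans (coord_le_norm x i) xh.
  by apply/bigmax_ltP; split => [|i _]; rewrite gE.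
apply: norm_lt_coord => // i; rewrite -(sgn i) ltr_norml lower/=.
by rewrite -gE; exact: gt.
Qed.

Lemma is_derive_prod_coord (R : realType) (n : nat) (f df : 'I_n -> R -> R)
    (x : 'rV[R]_n) (j : 'I_n) : (forall i (t : R), is_derive t 1 (f i) (df i t)) ->
  is_derive x (delta_mx 0 j) (fun y => \prod_i f i (y 0 i))
    (\prod_i (if i == j then df i else f i) (x 0 i)).
Proof.
move=> fd; pose F (y : 'rV[R]_n) := f j (y 0 j).
pose G (y : 'rV[R]_n) := \prod_(i | i != j) f i (y 0 i).
have Fd : is_derive x (delta_mx 0 j) F (df j (x 0 j)).
  by have := @is_derive_comp_coord _ _ (f j) x j j _ (fd j (x 0 j)); rewrite eqxx mul1r.
have Gd : is_derive x (delta_mx 0 j) G 0.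
  apply: is_derive_stationary => h; apply: eq_bigr => i ij.
  by rewrite !mxE eqxx/= (negbTE ij) mulr0 add0r.
have -> : (fun y : 'rV[R]_n => \prod_i f i (y 0 i)) = F * G.
  by apply/funext => y; rewrite (bigD1 j).
have := is_deriveM Fd Gd; rewrite scaler0 add0r.
congr (is_derive _ _ _ _); rewrite (bigD1 j)//= eqxx /GRing.scale/= mulrC.
by congr (_ * _); apply: eq_bigr => i /negbTE ->.
Qed.

Lemma continuous_prod_coord (R : realType) (n : nat) (f : 'I_n -> R -> R) :
  (forall i, continuous (f i)) ->
  continuous (fun y : 'rV[R]_n => \prod_i f i (y 0 i)).
Proof.
move=> cf; elim: (index_enum _) => [|i s IHs].
  by under eq_fun do rewrite big_nil; exact: cst_continuous.
under eq_fun do rewrite big_cons; apply: continuous_mul => //.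
have cc : continuous (fun x : 'rV[R]_n => x 0 i) by exact: coord_continuous.
by move=> y; exact: (cvg_comp _ _ (cc y) (cf i _)).
Qed.

Lemma prod_cos_C2 (R : realType) (n : nat) (U : set 'rV[R]_n) :
  let u := fun x : 'rV[R]_n => \prod_i cos (x 0 i) in
  C2_on U u /\ forall x, laplacian u x = - (n%:R * u x).
Proof.
move=> u.
have ccos : continuous (@cos R) by exact: continuous_cos.
have cNsin : continuous (fun t : R => - sin t) by apply: continuous_opp; exact: continuous_sin.
pose f1 j (i : 'I_n) := if i == j then fun t : R => - sin t else cos.
pose df1 j (i : 'I_n) := if i == j then fun t : R => - cos t else fun t => - sin t.
have cf1 j i : continuous (f1 j i) by rewrite /f1; case: ifP.
have [C1u pu] : C1_on U u /\ forall j, partial j u = fun x => \prod_i f1 j i (x 0 i).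
  apply: C1_on_is_derive => [x j|j]; last exact: continuous_prod_coord.
  exact: (@is_derive_prod_coord _ _ (fun=> cos) (fun _ t => - sin t)).
have p2 j : C1_on U (partial j u) /\ forall k, partial k (partial j u) =
    fun x => \prod_i (if i == k then df1 j i else f1 j i) (x 0 i).
  rewrite pu; apply: C1_on_is_derive => [x k|k].
    apply: is_derive_prod_coord => i t; rewrite /f1 /df1; case: ifP => _; last exact: is_derive_cos.
    by have := is_deriveN (is_derive_sin t).
  apply: (@continuous_prod_coord _ _ (fun i => if i == k then df1 j i else f1 j i)) => i.
  case: ifP => // _; rewrite /df1; case: ifP => // _.
  exact: continuous_opp.
split; first by split; [exact: C1u|move=> j; have [] := p2 j].
move=> x; rewrite /laplacian (eq_bigr (fun=> - u x)) => [|j _].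
  by rewrite sumr_const card_ord mulNrn mulr_natl.
have [_ ->] := p2 j; rewrite /u (bigD1 j)//= [in RHS](bigD1 j)//= !eqxx /df1 eqxx mulNr.
congr (- (_ * _)); apply: eq_bigr => i ij.
by rewrite (negbTE ij) /f1 (negbTE ij).
Qed.

(** The product of the cosines of the coordinates is an eigenfunction for [n]: a
    point of the boundary of the cube has a coordinate [pi / 2] or [- pi / 2]. *)
Lemma lambda1_cube (R : realType) (n : nat) :
  (lambda 1 (@cube R n (pi / 2)) <= n%:R%:E)%E.
Proof.
have h0 : 0 < pi / 2 :> R by rewrite divr_gt0// pi_gt0.
pose u := fun x : 'rV[R]_n => \prod_i cos (x 0 i).
have [C2u lu] : C2_on (@cube R n (pi / 2)) u /\ forall x, laplacian u x = - (n%:R * u x).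
  exact: prod_cos_C2.
have cu : continuous u.
  by apply: (@continuous_prod_coord _ _ (fun=> cos)) => _; exact: continuous_cos.
pose w := u \_ (@cube R n (pi / 2)).
have uw x : cube (pi / 2) x -> u x = w x by move=> Qx; rewrite /w patchE mem_set.
have uwc x : closure (cube (pi / 2)) x -> u x = w x.
  move=> /closure_cube xh; have [/uw//|nQx] := pselect (cube (pi / 2) x).
  rewrite /w patchE memNset//.
  have [i xi] : exists i, pi / 2 <= `|x 0 i|.
    apply: contrapT => /forallNP noi; apply: nQx; apply: norm_lt_coord => // i.
    by rewrite ltNge; apply/negP; exact: noi.
  have {xi} xi : `|x 0 i| = pi / 2.
    by apply/eqP; rewrite eq_le xi (le_trans (coord_le_norm x i)).
  rewrite /u (bigD1 i)//= (_ : cos (x 0 i) = 0) ?mul0r//.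
  move: xi; case: (ger0P (x 0 i)) => _ xi; first by rewrite xi cos_pihalf.
  by rewrite -cosN xi cos_pihalf.
have oQ := @open_cube R n (pi / 2).
have ew : dirichlet_eigenfunction (cube (pi / 2)) n%:R w.
  split.
  - exact: C2_on_eq C2u.
  - apply: (@subspace_eq_continuous _ _ _ (u : subspace (closure (cube (pi / 2))) -> R)).
      by move=> x; rewrite inE; exact: uwc.
    exact: continuous_subspaceT.
  - by move=> x Qx; rewrite /w patchE memNset.
  - by move=> x Qx; rewrite -(laplacian_eq oQ uw Qx) lu opprK uw.
apply: lambda_le; apply: (@le_trans _ _ (multiplicity (cube (pi / 2)) n%:R)).
  apply: (@multiplicity_ge _ _ 1 _ _ (fun=> w)) => [_|c cw j]; first exact: ew.
  have Q0 : @cube R n (pi / 2) 0 by rewrite /cube/= normr0.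
  have := cw 0; rewrite big_ord1 -uw// /u big1 => [|i _]; last by rewrite mxE cos0.
  by rewrite mulr1 (ord1 j).
apply: esum_ge; exists [set n%:R]; last by rewrite fsbig_set1.
by split => [|_ ->/=].
Qed.

(** * Volume *)

Lemma volume_ge0 (R : realType) (n : nat) (A : set 'rV[R]_n) : (0 <= volume A)%E.
Proof.
apply: le_ereal_inf_tmp => _ [a [b [ab _ ->]]]; apply: nneseries_ge0 => j _ _.
by rewrite lee_fin prodr_ge0// => i _; rewrite subr_ge0.
Qed.

Lemma volume_le (R : realType) (n : nat) (A B : set 'rV[R]_n) :
  A `<=` B -> (volume A <= volume B)%E.
Proof.
move=> AB; apply: ereal_inf_le_tmp => s [a [b [ab Bab ->]]].
by exists a, b; split => //; exact: subset_trans Bab.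
Qed.

Lemma volume_lty (R : realType) (n : nat) (A : set 'rV[R]_n) :
  (0 < n)%N -> bounded_set A -> (volume A < +oo)%E.
Proof.
case: n A => // n A _ [M [_ AM]].
pose r := `|M| + 1.
have Ar x : A x -> `|x| <= r by apply: AM; rewrite (le_lt_trans (ler_norm _))// ltrDl.
have r0 : 0 <= r by rewrite addr_ge0.
(* One box of side [2 * r], and degenerate boxes of volume zero. *)
pose b j : 'rV[R]_n.+1 := if j == 0%N then const_mx r else 0.
have bE j i : b j 0 i = if j == 0%N then r else 0 by rewrite /b; case: ifP; rewrite mxE.
have b0 j i : 0 <= b j 0 i by rewrite bE; case: ifP.
apply: (@le_lt_trans _ _ (\sum_(0 <= j <oo)
    (\prod_(i < n.+1) (b j 0 i - (- b j) 0 i))%:E)%E).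
  apply: ereal_inf_lbound; exists (fun j => - b j), b; split => //.
    by move=> j i; rewrite mxE ge0_cp.
  move=> x Ax; exists 0%N => // i; rewrite mxE bE/= -ler_norml.
  exact: le_trans (coord_le_norm x i) (Ar x Ax).
rewrite nneseries_recl// => [|j _]; last first.
  by rewrite lee_fin prodr_ge0// => i _; rewrite mxE opprK addr_ge0.
rewrite eseries0 ?adde0 ?ltry// => j j0 _.
by rewrite big_ord_recl !mxE bE gtn_eqF// oppr0 subrr mul0r.
Qed.

(** Interleave a covering of [A] with a covering of [B]. *)
Lemma volume_setU_le (R : realType) (n : nat) (A B : set 'rV[R]_n) :
  volume A \is a fin_num -> volume B \is a fin_num ->
  (volume (A `|` B) <= volume A + volume B)%E.
Proof.
move=> fA fB; apply/lee_addgt0Pr => e e0; have e20 : 0 < e / 2 by rewrite divr_gt0.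
have [_ [a [b [ab Aab ->]]] Ae] := lb_ereal_inf_adherent e20 fA.
have [_ [a' [b' [ab' Bab ->]]] Be] := lb_ereal_inf_adherent e20 fB.
pose pick T (f g : nat -> T) j := if odd j then g j./2 else f j./2.
pose F j := (\prod_(i < n) (b j 0 i - a j 0 i))%:E.
pose G j := (\prod_(i < n) (b' j 0 i - a' j 0 i))%:E.
have F0 j : (0 <= F j)%E by rewrite lee_fin prodr_ge0// => i _; rewrite subr_ge0.
have G0 j : (0 <= G j)%E by rewrite lee_fin prodr_ge0// => i _; rewrite subr_ge0.
have FG0 j : (0 <= pick _ F G j)%E by rewrite /pick; case: ifP.
apply: (@le_trans _ _ (\sum_(0 <= j <oo) pick _ F G j)%E).
  apply: ereal_inf_lbound; exists (pick _ a a'), (pick _ b b'); split.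
  - by move=> j i; rewrite /pick; case: ifP.
  - move=> x [/Aab[j _ xj]|/Bab[j _ xj]].
      by exists j.*2 => //; rewrite /pick odd_double doubleK.
    by exists j.*2.+1 => //; rewrite /pick /= odd_double uphalf_double.
  - by apply: eq_eseriesr => j _; rewrite /pick /F /G; case: ifP.
have half N : (\sum_(0 <= j < N.*2) pick _ F G j = \sum_(0 <= j < N) (F j + G j))%E.
  elim: N => [|N IHN]; first by rewrite !big_geq.
  rewrite doubleS !big_nat_recr//= IHN -addeA; congr (_ + (_ + _))%E.
    by rewrite /pick odd_double doubleK.
  by rewrite /pick /= odd_double uphalf_double.
apply: (@le_trans _ _ (\sum_(0 <= j <oo) (F j + G j))%E).
  apply: lime_le; first exact: is_cvg_nneseries.
  near=> N; apply: (@le_trans _ _ (\sum_(0 <= j < N.*2) pick _ F G j)%E).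
    by apply: lee_sum_nneg_natr => //; rewrite -addnn leq_addr.
  by rewrite half; apply: nneseries_lim_ge => j _ _; rewrite adde_ge0.
rewrite nneseriesD//; apply: (le_trans (leeD (ltW Ae) (ltW Be))).
by rewrite addeACA -EFinD -splitr.
Unshelve. all: by end_near. Qed.

Lemma volume_similar_set_le (R : realType) (n : nat) (A : set 'rV[R]_n) (s : R)
    (c : 'rV[R]_n) : 0 < s ->
  (volume (similar_set s c A) <= (s^-1 ^+ n)%:E * volume A)%E.
Proof.
move=> s0; have sn0 : 0 < s^-1 ^+ n by rewrite exprn_gt0 ?invr_gt0.
rewrite {2}/volume -ereal_inf_pZl//.
apply: le_ereal_inf_tmp => _ [_ [a [b [ab Aab ->]]] <-].
apply: ereal_inf_lbound.
exists (fun j => s^-1 *: (a j - c)), (fun j => s^-1 *: (b j - c)); split.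
- by move=> j i; rewrite !mxE ler_pM2l ?invr_gt0// lerD2r.
- move=> x /Aab[j _ xj]; exists j => // i; have := xj i; rewrite !mxE.
  by rewrite ler_pdivrMl// ler_pdivlMl// lerBlDr lerBrDr.
- rewrite -nneseriesZl => [|j _]; last first.
    by rewrite lee_fin prodr_ge0// => i _; rewrite subr_ge0.
  apply: eq_eseriesr => j _; rewrite -EFinM; congr EFin.
  rewrite -[X in s^-1 ^+ X](card_ord n) -prodr_const -big_split/=.
  by apply: eq_bigr => i _; rewrite !mxE -mulrBr opprB addrA subrK.
Qed.

Lemma volume_similar_set (R : realType) (n : nat) (A : set 'rV[R]_n) (s : R)
    (c : 'rV[R]_n) : 0 < s ->
  volume (similar_set s c A) = ((s^-1 ^+ n)%:E * volume A)%E.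
Proof.
move=> s0; have sV0 : 0 < s^-1 by rewrite invr_gt0.
apply/eqP; rewrite eq_le volume_similar_set_le//=.
rewrite -{1}(@similar_setK _ _ s c A s0) -lee_pdivlMl ?exprn_gt0//.
apply: (le_trans (volume_similar_set_le _ _ sV0)).
by rewrite invrK exprVn invrK.
Qed.

(** * Scaling and subadditivity of the infimal eigenvalues *)

Lemma lambda_star_ge0 (R : realType) (n k : nat) : (0 < n)%N -> (0 < k)%N ->
  (0 <= lambda_star R n k)%E.
Proof.
move=> n0 k0; apply: le_ereal_inf_tmp => _ [W [[bW oW _] _] <-].
by apply: ltW; exact: lambda_gt0.
Qed.

Lemma poweR_half_le (R : realType) (n : nat) (x y : \bar R) :
  (0 <= x)%E -> (x <= y)%E -> (x `^ (n%:R / 2) <= y `^ (n%:R / 2))%E.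
Proof.
move=> x0 xy; apply: gt0_ler_poweR => //; rewrite ?divr_ge0//.
  by rewrite in_itv/= x0 leey.
by rewrite in_itv/= (le_trans x0 xy) leey.
Qed.

Lemma powR_sqr_half (R : realType) (n : nat) (s : R) : 0 <= s ->
  (s ^+ 2) `^ (n%:R / 2) = s ^+ n.
Proof.
move=> s0; rewrite -powR_mulrn// -powRrM -powR_mulrn//.
by congr (_ `^ _); field.
Qed.

(** The similar domain of volume 1 competes in the infimum; the exponent [n / 2]
    is the one for which the scaling factors of eigenvalue and volume cancel. *)
Lemma lambda_star_le (R : realType) (n k : nat) (W : set 'rV[R]_n) :
  (0 < n)%N -> (0 < k)%N -> domain W -> (0 < volume W)%E ->
  (lambda_star R n k `^ (n%:R / 2) <= lambda k W `^ (n%:R / 2) * volume W)%E.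
Proof.
move=> n0 k0 dW; have [bW oW _] := dW; have := volume_lty n0 bW.
case E : (volume W) => [v| |]// _; rewrite lte_fin => v0.
pose s := v `^ n%:R^-1; have s0 : 0 < s by rewrite powR_gt0.
have sn : s ^+ n = v.
  by rewrite -powR_mulrn ?ltW// -powRrM mulVf ?pnatr_eq0 -?lt0n// powRr1// ltW.
have volW' : volume (similar_set s 0 W) = 1%:E.
  by rewrite volume_similar_set// E exprVn sn -EFinM mulVf// gt_eqF.
have lW := @lambda_similar_set _ _ k _ s 0 oW s0.
apply: (@le_trans _ _ (((s ^+ 2)%:E * lambda k W) `^ (n%:R / 2))%E).
  apply: poweR_half_le; first exact: lambda_star_ge0.
  apply: le_trans lW; apply: ereal_inf_lbound.
  by exists (similar_set s 0 W) => //; split => //; exact: domain_similar_set.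
rewrite poweRM ?lee_fin ?sqr_ge0//; last by apply: ltW; exact: lambda_gt0.
by rewrite poweR_EFin (powR_sqr_half _ (ltW s0)) sn muleC.
Qed.

Lemma bounded_similar_far (R : realType) (n : nat) (W : set 'rV[R]_n) (s b : R)
    (i : 'I_n) : 0 < s -> bounded_set W ->
  exists c, forall x, similar_set s c W x -> b <= x 0 i.
Proof.
move=> s0 [M [_ WM]]; exists (- (s * b + M + 1) *: delta_mx 0 i) => x.
rewrite /similar_set/= => /WM => /(_ (M + 1)); rewrite ltrDl ltr01 => /(_ isT).
move=> /(le_trans (coord_le_norm _ i)); rewrite !mxE !eqxx mulr1 => /ler_normlP[h _].
by rewrite -(ler_pM2l s0); lra.
Qed.

(** The Wolf-Keller construction. The two domains, scaled so that the eigenvalues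
    considered become 1, have volumes [lambda i V `^ (n / 2)] and
    [lambda j W `^ (n / 2)]. Placed side by side they form a domain whose
    eigenvalue of rank [i + j] is at most 1, to which [lambda_star_le] applies. *)
Lemma lambda_star_setU (R : realType) (n i j : nat) (V W : set 'rV[R]_n) :
  (0 < n)%N -> (0 < i)%N -> (0 < j)%N ->
  domain V -> volume V = 1%:E -> domain W -> volume W = 1%:E ->
  (lambda_star R n (i + j) `^ (n%:R / 2) <=
   lambda i V `^ (n%:R / 2) + lambda j W `^ (n%:R / 2))%E.
Proof.
move=> n0 i0 j0 dV V1 dW W1; have [bV oV _] := dV; have [bW oW _] := dW.
have r0 : n%:R / 2 != 0 :> R by rewrite mulf_neq0// ?invr_eq0 pnatr_eq0 -?lt0n.
have := lambda_gt0 n0 i0 bV oV; case EV : (lambda i V) => [a| |]//; last first.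
  by move=> _; rewrite poweRyr// addye ?leey// gt_eqF// (lt_le_trans _ (poweR_ge0 _ _))// ltNyr.
have := lambda_gt0 n0 j0 bW oW; case EW : (lambda j W) => [b| |]//; last first.
  by move=> _ _; rewrite (poweRyr r0) addey ?leey.
rewrite !lte_fin => b0 a0.
have unit_scale (x : R) : 0 < x ->
    exists s, [/\ 0 < s, s ^+ 2 * x = 1 & s^-1 ^+ n = x `^ (n%:R / 2)].
  move=> x0; exists (Num.sqrt x)^-1; have sx0 : 0 < Num.sqrt x by rewrite sqrtr_gt0.
  split; first by rewrite invr_gt0.
  - by rewrite exprVn sqr_sqrtr ?mulVf ?gt_eqF// ltW.
  - by rewrite invrK -powR_sqr_half ?ltW// sqr_sqrtr// ltW.
have [s [s0 sa sn]] := unit_scale a a0; have [t [t0 tb tn]] := unit_scale b b0.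
pose i1 : 'I_n := Ordinal n0.
have dV' := @domain_similar_set _ _ V s 0 s0 dV; set V' := similar_set s 0 V in dV'.
have [[M [_ V'M]] oV' _] := dV'.
have V'M1 x : V' x -> x 0 i1 <= M + 1.
  move=> /V'M => /(_ (M + 1)); rewrite ltrDl ltr01 => /(_ isT).
  by move=> /(le_trans (coord_le_norm _ i1))/(le_trans (ler_norm _)).
have [c W'M] := bounded_similar_far (M + 2) i1 t0 bW.
have dW' := @domain_similar_set _ _ W t c t0 dW; set W' := similar_set t c W in dW' W'M.
have [_ oW' _] := dW'.
have MM : M + 1 < M + 2 by rewrite ltrD2l ltr1n.
have dU : domain (V' `|` W') by exact: domain_setU MM V'M1 W'M dV' dW'.
have VW0 : V' `&` W' = set0.
  by apply/seteqP; split => // x [/V'M1 xM /W'M /le_trans/(_ xM)]; rewrite leNgt MM.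
have volV' : volume V' = (a `^ (n%:R / 2))%:E by rewrite volume_similar_set// V1 mule1 sn.
have volW' : volume W' = (b `^ (n%:R / 2))%:E by rewrite volume_similar_set// W1 mule1 tn.
have lU : (lambda (i + j) (V' `|` W') <= 1%:E)%E.
  apply: lambda_setU_le => //.
    by apply: (le_trans (lambda_similar_set _ _ _ s0)) => //; rewrite EV -EFinM sa.
  by apply: (le_trans (lambda_similar_set _ _ _ t0)) => //; rewrite EW -EFinM tb.
have volU0 : (0 < volume (V' `|` W'))%E.
  apply: (@lt_le_trans _ _ (volume V')); first by rewrite volV' lte_fin powR_gt0.
  by apply: volume_le => x; left.
have ij0 : (0 < i + j)%N by rewrite addn_gt0 i0.
apply: (le_trans (lambda_star_le n0 ij0 dU volU0)).
apply: (@le_trans _ _ (1 * (volume V' + volume W'))%E); last first.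
  by rewrite mul1e volV' volW' !poweR_EFin.
apply: lee_pmul; rewrite ?poweR_ge0 ?volume_ge0//; last first.
  by apply: volume_setU_le; rewrite ?volV' ?volW'.
rewrite -(@poweR1r R (n%:R / 2)); apply: poweR_half_le => //.
by have [bU oU _] := dU; apply: ltW; exact: lambda_gt0.
Qed.

(** The map [x |-> x `^ (n / 2)] is increasing and continuous, so the inequality
    passes to the infimum. *)
Lemma poweR_inf_ge (R : realType) (n : nat) (S : set (\bar R)) (c d : \bar R) :
  (0 < n)%N -> (forall x, S x -> (0 <= x)%E) -> (0 <= d)%E ->
  (forall x, S x -> (c <= x `^ (n%:R / 2) + d)%E) ->
  (c <= ereal_inf S `^ (n%:R / 2) + d)%E.
Proof.
move=> n0 S0 d0 cS; rewrite leNgt; apply/negP.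
have r0 : 0 < n%:R / 2 :> R by rewrite divr_gt0// ltr0n.
have m0 : (0 <= ereal_inf S)%E by apply: le_ereal_inf_tmp.
case Em : (ereal_inf S) m0 => [m| |]// m0; last first.
  rewrite poweRyr ?gt_eqF// addye ?ltNge ?leey//.
  by rewrite gt_eqF// (lt_le_trans (ltNyr 0) d0).
case: d d0 cS => [d| |]// d0 cS; last by rewrite addey// ltNge leey.
rewrite poweR_EFin -EFinD => mc.
have [y my yc] : exists2 y : R, m `^ (n%:R / 2) < y & ((y + d)%:E <= c)%E.
  case: c mc {cS} => [c| |]// mc; last by exists (m `^ (n%:R / 2) + 1); rewrite ?ltrDl ?leey.
  by exists (c - d); rewrite ?subrK// ltrBrDr; rewrite lte_fin in mc.
have y0 : 0 < y by apply: le_lt_trans my; exact: powR_ge0.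
pose z := y `^ (n%:R / 2)^-1.
have zy : z `^ (n%:R / 2) = y by rewrite -powRrM mulVf ?gt_eqF// powRr1// ltW.
have mz : m < z.
  rewrite ltNge; apply/negP => zm; move: my; rewrite ltNge => /negP; apply.
  by rewrite -zy; apply: ge0_ler_powR; rewrite ?nnegrE ?powR_ge0// ltW.
have [x Sx xz] : exists2 x, S x & (x < z%:E)%E.
  by apply: ereal_inf_lt; rewrite Em lte_fin.
have := S0 x Sx; have := cS x Sx; move: xz; case: x Sx => [x| |]// Sx.
rewrite lte_fin lee_fin poweR_EFin -EFinD => xz cx x0.
have := le_trans yc cx; rewrite lee_fin lerD2r leNgt => /negP; apply.
by rewrite -zy gt0_ltr_powR// nnegrE// powR_ge0.
Qed.

Lemma lambda_star_subadd (R : realType) (n i j : nat) :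
  (0 < n)%N -> (0 < i)%N -> (0 < j)%N ->
  (lambda_star R n (i + j) `^ (n%:R / 2) <=
   lambda_star R n i `^ (n%:R / 2) + lambda_star R n j `^ (n%:R / 2))%E.
Proof.
move=> n0 i0 j0; apply: poweR_inf_ge => //.
- by move=> _ [W [[bW oW _] _] <-]; apply: ltW; exact: lambda_gt0.
- exact: poweR_ge0.
move=> _ [V [dV V1] <-]; rewrite addeC; apply: poweR_inf_ge => //.
- by move=> _ [W [[bW oW _] _] <-]; apply: ltW; exact: lambda_gt0.
- exact: poweR_ge0.
by move=> _ [W [dW W1] <-]; rewrite addeC; exact: lambda_star_setU.
Qed.

(** Subadditivity reduces the claim to [k = 1], which a cube settles once its
    volume is positive; this is where [A] comes in, as it fits into a large
    cube. *)
Lemma lambda_star_lty (R : realType) (n k : nat) (A : set 'rV[R]_n) :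
  (0 < n)%N -> (0 < k)%N -> bounded_set A -> (0 < volume A)%E ->
  (lambda_star R n k < +oo)%E.
Proof.
move=> n0 k0 [M [_ AM]] A0.
have h0 : 0 < pi / 2 :> R by rewrite divr_gt0// pi_gt0.
pose Q := @cube R n (pi / 2); have dQ : domain Q by exact: domain_cube.
pose r := `|M| + 1; have r0 : 0 < r by rewrite ltr_wpDl.
have r10 : 0 < r + 1 by exact: addr_gt0.
pose s := pi / 2 / (r + 1); have s0 : 0 < s by rewrite divr_gt0.
have volQ : (0 < volume Q)%E.
  have : (0 < volume (similar_set s 0 Q))%E.
    apply: (lt_le_trans A0); apply: volume_le => x /AM xM.
    have {}xM : `|x| <= r by apply: xM; rewrite (le_lt_trans (ler_norm _))// ltrDl.
    rewrite /similar_set /Q /cube/= addr0 normrZ gtr0_norm// mulrAC ltr_pdivrMr//.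
    by rewrite ltr_pM2l// (le_lt_trans xM)// ltrDl.
  by rewrite volume_similar_set// pmule_rgt0// lte_fin exprn_gt0 ?invr_gt0.
have r20 : n%:R / 2 != 0 :> R by rewrite mulf_neq0// ?invr_eq0 pnatr_eq0 -?lt0n.
have L1 : (lambda_star R n 1 `^ (n%:R / 2) < +oo)%E.
  apply: (le_lt_trans (lambda_star_le n0 (ltn0Sn 0) dQ volQ)).
  apply: lte_mul_pinfty; first exact: poweR_ge0.
    apply: fin_num_poweR; rewrite ge0_fin_numE; last first.
      by have [bQ oQ _] := dQ; apply: ltW; exact: lambda_gt0.
    exact: le_lt_trans (@lambda1_cube R n) (ltry _).
  by have [bQ _ _] := dQ; exact: volume_lty.
apply: (lty_poweRy r20); case: k k0 => // k _; elim: k => // k IHk.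
rewrite -addn1; apply: (le_lt_trans (lambda_star_subadd R n0 (ltn0Sn k) (ltn0Sn 0))).
exact: lte_add_pinfty.
Qed.

(** * Splitting the eigenvalues of a non-connected almost-minimiser *)

Unset Implicit Arguments.

Local Open Scope ereal_scope.

Theorem theorem2p2 (R : realType) (n k : nat) (eps : R)
    (A B : set 'rV[R]_n) :
  (2 <= n)%N -> (2 <= k)%N -> (0 <= eps)%R ->
  domain A -> domain B -> A `&` B = set0 ->
  domain (A `|` B) -> ~ connected (A `|` B) ->
  volume A + volume B = 1 ->
  eps%:E / lambda_star R n k `^ (n%:R / 2) < volume A ->
  eps%:E / lambda_star R n k `^ (n%:R / 2) < volume B ->
  lambda k (A `|` B) `^ (n%:R / 2) <=
    lambda_star R n k `^ (n%:R / 2) + eps%:E ->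
  exists i : nat,
    [/\ (1 <= i <= k - 1)%N,
        0 <= (lambda_star R n i `^ (n%:R / 2)
              + lambda_star R n (k - i) `^ (n%:R / 2))
             - lambda_star R n k `^ (n%:R / 2) <= eps%:E,
        0 <= lambda i A `^ (n%:R / 2) * volume A
             - lambda_star R n i `^ (n%:R / 2) <= eps%:E &
        0 <= lambda (k - i) B `^ (n%:R / 2) * volume B
             - lambda_star R n (k - i) `^ (n%:R / 2) <= eps%:E].
Proof.
move=> n2 k2 eps0 dA dB AB0 [bAB oAB _] _ volAB Abig Bbig almost.
have n0 : (0 < n)%N by exact: leq_trans n2.
have k0 : (0 < k)%N by exact: leq_trans k2.
have [bA oA _] := dA; have [bB oB _] := dB.
have r0 : (0 < n%:R / 2 :> R)%R by rewrite divr_gt0// ltr0n.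
have quot0 : 0 <= eps%:E / lambda_star R n k `^ (n%:R / 2).
  by rewrite mule_ge0 ?lee_fin// inve_ge0 poweR_ge0.
have volA0 := le_lt_trans quot0 Abig; have volB0 := le_lt_trans quot0 Bbig.
have real_star j : (0 < j)%N ->
    exists2 l : R, (0 <= l)%R & lambda_star R n j `^ (n%:R / 2) = l%:E.
  move=> j0; have := lambda_star_lty n0 j0 bA volA0.
  move=> /(poweR_lty (n%:R / 2)); have := poweR_ge0 (lambda_star R n j) (n%:R / 2).
  by case: (_ `^ _) => // l l0 _; exists l.
have [l l0 lE] := real_star k k0.
have [Lam LamE Lam_le] : exists2 Lam : R,
    lambda k (A `|` B) `^ (n%:R / 2) = Lam%:E & (Lam <= l + eps)%R.
  move: almost; have := poweR_ge0 (lambda k (A `|` B)) (n%:R / 2).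
  by rewrite lE; case: (_ `^ _) => // Lam _; rewrite -EFinD lee_fin; exists Lam.
have lam0 : 0 < lambda k (A `|` B) by exact: lambda_gt0.
have Lam0 : (0 < Lam)%R by rewrite -lte_fin -LamE poweR_gt0.
have [vA vAE] : exists vA, volume A = vA%:E.
  by have := volume_lty n0 bA; case: (volume A) volA0 => // vA _ _; exists vA.
have [vB vBE] : exists vB, volume B = vB%:E.
  by have := volume_lty n0 bB; case: (volume B) volB0 => // vB _ _; exists vB.
have vAB : (vA + vB = 1)%R.
  by move: volAB; rewrite vAE vBE -EFinD => -[].
(* If the infimum vanished, the condition on the volumes would read
   [+oo < vA] unless [eps = 0], and then [Lam <= 0]. *)
have lpos : (0 < l)%R.
  rewrite lt_neqAle l0 andbT; apply/eqP => l00.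
  have [e0|e0] := ltP 0%R eps; last by move: Lam_le Lam0 e0; rewrite -l00; lra.
  by move: Abig; rewrite lE -l00 inve0 gt0_muley ?lte_fin// vAE.
have big v : eps%:E / lambda_star R n k `^ (n%:R / 2) < v%:E -> (eps < v * l)%R.
  by rewrite lE inver gt_eqF// -EFinM lte_fin ltr_pdivrMr.
have epsA : (eps < vA * l)%R by apply: big; rewrite -vAE.
have epsB : (eps < vB * l)%R by apply: big; rewrite -vBE.
(* The bound by [Lam] is also what makes the power of [lambda j W] a real. *)
have part j (W : set 'rV[R]_n) v m : (0 < j)%N -> domain W -> 0 < volume W -> volume W = v%:E ->
    lambda_star R n j `^ (n%:R / 2) = m%:E ->
    lambda j W <= lambda k (A `|` B) ->
    exists2 x : R, lambda j W `^ (n%:R / 2) = x%:E & (x <= Lam /\ m <= x * v)%R.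
  move=> j0 dW volW0 vE mE jW; have [bW oW _] := dW.
  have := poweR_half_le n (ltW (lambda_gt0 n0 j0 bW oW)) jW.
  have := lambda_star_le n0 j0 dW volW0; rewrite mE vE LamE.
  have := poweR_ge0 (lambda j W) (n%:R / 2).
  by case: (_ `^ _) => // x _; rewrite -EFinM !lee_fin => mx xL; exists x.
have vA0 : (0 < vA)%R by rewrite -lte_fin -vAE.
have vB0 : (0 < vB)%R by rewrite -lte_fin -vBE.
(* If a part of volume [v] carried all [k] eigenvalues, then
   [l <= Lam * v <= (l + eps) * (1 - v')], whereas [eps < v' * l]. *)
have too_small x v v' : (v + v' = 1)%R -> (0 < v)%R -> (0 < v')%R ->
    (eps < v' * l)%R -> (x <= Lam)%R -> (l <= x * v)%R -> False.
  move=> vv' v0 v'0 ev' xL lx.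
  have xv : (x * v <= (l + eps) * v)%R by rewrite ler_pM2r//; exact: le_trans xL Lam_le.
  have ev : (eps * v <= eps)%R by rewrite ler_piMr//; lra.
  have lv : (l * v = l - v' * l)%R by rewrite (_ : v = 1 - v')%R; [ring|lra].
  by move: xv; rewrite mulrDl lv; lra.
have [i [ik iA iB]] := lambda_setU_split k oA oB AB0.
have i0 : (0 < i)%N.
  rewrite lt0n; apply/eqP => i00; rewrite i00 subn0 in iB.
  have [x _ [xL lx]] := part k B vB l k0 dB volB0 vBE lE iB.
  by apply: (too_small x vB vA) => //; rewrite addrC.
have {}ik : (i < k)%N.
  rewrite ltn_neqAle ik andbT; apply/eqP => ikE; rewrite ikE in iA.
  have [x _ [xL lx]] := part k A vA l k0 dA volA0 vAE lE iA.
  exact: (too_small x vA vB).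
have ki0 : (0 < k - i)%N by rewrite subn_gt0.
have [p p0 pE] := real_star i i0; have [q q0 qE] := real_star (k - i)%N ki0.
have lpq : (l <= p + q)%R.
  have := lambda_star_subadd R n0 i0 ki0.
  by rewrite (subnKC (ltnW ik)) lE pE qE -EFinD lee_fin.
have [x xE [xL px]] := part i A vA p i0 dA volA0 vAE pE iA.
have [y yE [yL qy]] := part (k - i)%N B vB q ki0 dB volB0 vBE qE iB.
have sum_le : (x * vA + y * vB <= Lam)%R.
  by rewrite -[leRHS]mulr1 -vAB mulrDr lerD// ler_pM2r.
exists i; split; first by rewrite i0/= leq_subRL// add1n.
- by rewrite lE pE qE -EFinD !lee_fin; lra.
- by rewrite xE vAE pE -EFinM -EFinD !lee_fin; lra.
- by rewrite yE vBE qE -EFinM -EFinD !lee_fin; lra.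
Qed.
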